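(* Let $f_0:\mathbb{C}\to\hat{\mathbb{C}}$ be a transcendental meromorphic function of finite order $\rho>0$ satisfying: (KU1) $\infty$ is not an asymptotic value of $f_0$; (KU2) there exist a co-finite subset $\mathcal{P}^*$ of the set $\mathcal{P}$ of poles and $R^*>0$ with $\mathrm{dist}(\mathrm{Sing}(f_0^{-1}),a)>2R^*$ for all $a\in\mathcal{P}^*$; (KU3) there is $R^\dagger>0$ with $B(a_1,R^\dagger)\cap B(a_2,R^\dagger)=\emptyset$ for distinct poles; (KU4) there exist $M\in\mathbb{N}$, $\beta\geq0$ such that for each $a\in\mathcal{P}^*$, $1\leq m(a)\leq M$ and $|f_0(z)|\asymp|a|^{-\beta}|z-a|^{-m(a)}$, $|f_0'(z)|\asymp m(a)|a|^{-\beta}|z-a|^{-m(a)-1}$ for $z\in B(a,R^\dagger)$. Then there is $\varepsilon>0$ such that for every sequence $(c_n)$ in $\mathbb{C}$ with $|c_n|<\varepsilon$ for all $n$, $$\mathrm{HD}(I_\infty(F_+))\geq\frac{\rho M^*}{\beta+M^*+1}.$$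
   Context: $m(a)$ is pole multiplicity; $\mathrm{Sing}(f^{-1})$ the finite critical and asymptotic values; $A\asymp B$ means $C^{-1}A\leq B\leq CA$, $C\geq1$ independent of $a,z$. $M^*$ is the largest integer $1\leq M^*\leq M$ such that $\sum_{a\in\mathcal{P},m(a)=M^*}|a|^{-t}$ converges for $t>\rho$ and diverges for $t<\rho$. $f_n=f_0+c_n$, $F_+^n=f_n\circ\dots\circ f_1$; $\mathcal{J}(F_+)$ is the complement of the set of points with a neighborhood where all $F_+^n$ are defined and normal; $I_\infty(F_+)=\{z\in\mathcal{J}(F_+):F_+^n(z)\to\infty\}$. *)

(* Defs.v *)
From Stdlib Require Import Reals Lra List ClassicalDescription.
From Coquelicot Require Import Coquelicot.
Open Scope R_scope.

(* Riemann sphere: Chat = C ∪ {∞}, with None = ∞.                      *)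
Definition Chat := option C.

Definition fin (f : C -> Chat) (z : C) : C :=
  match f z with Some w => w | None => RtoC 0 end.

Definition cderiv (g : C -> C) (z d : C) : Prop :=
  @is_derive C_AbsRing C_NormedModule g z d.

Definition is_pole (f : C -> Chat) (a : C) : Prop := f a = None.

Definition pole_mult (f : C -> Chat) (a : C) (m : nat) : Prop :=
  is_pole f a /\ (1 <= m)%nat /\
  exists L : C, L <> RtoC 0 /\
    forall eps, 0 < eps -> exists del, 0 < del /\
      forall z, 0 < Cmod (Cminus z a) < del ->
        f z <> None /\
        Cmod (Cminus (Cmult (@pow_n C_Ring (Cminus z a) m) (fin f z)) L) < eps.

Definition meromorphic (f : C -> Chat) : Prop :=
  (forall z, exists r, 0 < r /\
     forall w, Cmod (Cminus w z) < r -> w <> z -> f w <> None) /\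
  (forall z, f z <> None -> exists d, cderiv (fin f) z d) /\
  (forall a, is_pole f a -> exists m, pole_mult f a m).

Definition polyval (n : nat) (a : nat -> C) (z : C) : C :=
  sum_n (fun k => Cmult (a k) (@pow_n C_Ring z k)) n.

Definition rational (f : C -> Chat) : Prop :=
  exists (n : nat) (p q : nat -> C),
    (exists k, (k <= n)%nat /\ q k <> RtoC 0) /\
    forall z, polyval n q z <> RtoC 0 ->
      f z = Some (Cdiv (polyval n p z) (polyval n q z)).

Definition transcendental_meromorphic (f : C -> Chat) : Prop :=
  meromorphic f /\ ~ rational f.

Definition logp (x : R) : R := Rmax 0 (ln x).

Definition prox (f : C -> Chat) (r : R) : R :=
  Rinv (2 * PI) *
  RInt (fun th : R => logp (Cmod (fin f (pair (r * cos th) (r * sin th))))) 0 (2 * PI).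

(* n(t,f): number of poles in |z| <= t, counted with multiplicity *)
Definition npoles (f : C -> Chat) (t : R) : R :=
  real (Lub_Rbar (fun x => exists l : list (prod C nat),
     NoDup (map fst l) /\
     List.Forall (fun p => Cmod (fst p) <= t /\ pole_mult f (fst p) (snd p)) l /\
     x = INR (list_sum (map snd l)))).

Definition Ncount (f : C -> Chat) (r : R) : R :=
  RInt (fun t => (npoles f t - npoles f 0) / t) 0 r + npoles f 0 * ln r.

Definition charT (f : C -> Chat) (r : R) : R := prox f r + Ncount f r.

(* rho = limsup_{r -> oo} log T(r,f) / log r.  The limsup is taken over
   radii r not equal to the modulus of a pole (a discrete set of radii),
   where the Riemann integral in m(r,f) is proper; since T(r,f) is
   continuous in r this does not change the limsup. *)
Definition good_radius (f : C -> Chat) (r : R) : Prop :=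
  forall a, is_pole f a -> Cmod a <> r.

Definition has_order (f : C -> Chat) (rho : R) : Prop :=
  (forall eps, 0 < eps -> exists R0, forall r, R0 < r -> good_radius f r ->
      ln (charT f r) / ln r < rho + eps) /\
  (forall eps, 0 < eps -> forall R0, exists r, R0 < r /\ good_radius f r /\
      rho - eps < ln (charT f r) / ln r).

Definition curve_to_inf (g : R -> C) : Prop :=
  (forall t, 0 <= t -> forall eps, 0 < eps -> exists del, 0 < del /\
     forall s, 0 <= s -> Rabs (s - t) < del -> Cmod (Cminus (g s) (g t)) < eps) /\
  (forall K, exists T, forall t, T <= t -> K < Cmod (g t)).

Definition asymptotic_value_inf (f : C -> Chat) : Prop :=
  exists g, curve_to_inf g /\
    forall K, exists T, forall t, T <= t -> f (g t) = None \/ K < Cmod (fin f (g t)).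

Definition asymptotic_value (f : C -> Chat) (w : C) : Prop :=
  exists g, curve_to_inf g /\
    forall eps, 0 < eps -> exists T, forall t, T <= t ->
      exists v, f (g t) = Some v /\ Cmod (Cminus v w) < eps.

Definition critical_value (f : C -> Chat) (w : C) : Prop :=
  exists z, f z = Some w /\ cderiv (fin f) z (RtoC 0).

Definition sing (f : C -> Chat) (w : C) : Prop :=
  critical_value f w \/ asymptotic_value f w.

Definition pole_series_cv (f : C -> Chat) (k : nat) (t : R) : Prop :=
  exists B, forall l : list C, NoDup l ->
    List.Forall (fun a => pole_mult f a k /\ a <> RtoC 0) l ->
    fold_right Rplus 0 (map (fun a => Rpower (Cmod a) (- t)) l) <= B.

Definition exponent_is (f : C -> Chat) (rho : R) (k : nat) : Prop :=
  (forall t, rho < t -> pole_series_cv f k t) /\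
  (forall t, t < rho -> ~ pole_series_cv f k t).

Definition is_Mstar (f : C -> Chat) (rho : R) (M Mstar : nat) : Prop :=
  (1 <= Mstar <= M)%nat /\ exponent_is f rho Mstar /\
  forall k, (Mstar < k <= M)%nat -> ~ exponent_is f rho k.

(* Non-autonomous iteration f_n = f0 + c_n, F^n = f_n o ... o f_1.      *)
Definition Fit (f0 : C -> Chat) (c : nat -> C) : nat -> C -> Chat :=
  fix F n z := match n with
  | O => Some z
  | S n' => match F n' z with
            | Some w => match f0 w with
                        | Some v => Some (Cplus v (c (S n')))
                        | None => None
                        end
            | None => None
            end
  end.

Definition chordal (u v : Chat) : R :=
  match u, v with
  | Some z, Some w => 2 * Cmod (Cminus z w) /
                      sqrt ((1 + (Cmod z)^2) * (1 + (Cmod w)^2))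
  | Some z, None | None, Some z => 2 / sqrt (1 + (Cmod z)^2)
  | None, None => 0
  end.

Definition ballC (z : C) (r : R) (w : C) : Prop := Cmod (Cminus w z) < r.

Definition normal_on (F : nat -> C -> Chat) (U : C -> Prop) : Prop :=
  forall phi : nat -> nat, exists (psi : nat -> nat) (g : C -> Chat),
    (forall j, (psi j < psi (S j))%nat) /\
    forall z0, U z0 -> exists r, 0 < r /\ (forall w, ballC z0 r w -> U w) /\
      forall eps, 0 < eps -> exists J, forall j, (J <= j)%nat ->
        forall w, ballC z0 r w -> chordal (F (phi (psi j)) w) (g w) < eps.

Definition fatou (f0 : C -> Chat) (c : nat -> C) (z : C) : Prop :=
  exists r, 0 < r /\
    (forall n w, ballC z r w -> Fit f0 c n w <> None) /\
    normal_on (Fit f0 c) (ballC z r).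

Definition julia (f0 : C -> Chat) (c : nat -> C) (z : C) : Prop :=
  ~ fatou f0 c z.

Definition escaping (f0 : C -> Chat) (c : nat -> C) (z : C) : Prop :=
  julia f0 c z /\
  (forall n, Fit f0 c n z <> None) /\
  (forall K, exists N, forall n, (N <= n)%nat -> K < Cmod (fin (Fit f0 c n) z)).

Definition diam_le (U : C -> Prop) (r : R) : Prop :=
  forall x y, U x -> U y -> Cmod (Cminus x y) <= r.

(* sum_i diam(U_i)^s, with r_i >= diam U_i, empty sets contributing 0 *)
Definition cover_cost (U : nat -> C -> Prop) (r : nat -> R) (s : R) : Rbar :=
  Lub_Rbar (fun x => exists n, x = sum_f_R0 (fun i =>
     if excluded_middle_informative (exists w, U i w) then Rpower (r i) s else 0) n).

Definition hausdorff_content (s d : R) (E : C -> Prop) : Rbar :=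
  Rbar_glb (fun x => exists (U : nat -> C -> Prop) (r : nat -> R),
     (forall i, 0 < r i <= d /\ diam_le (U i) (r i)) /\
     (forall z, E z -> exists i, U i z) /\
     x = cover_cost U r s).

Definition hausdorff_measure (s : R) (E : C -> Prop) : Rbar :=
  Rbar_lub (fun x => exists d, 0 < d /\ x = hausdorff_content s d E).

Definition hausdorff_dim (E : C -> Prop) : Rbar :=
  Rbar_glb (fun x => exists s, 0 <= s /\ x = Finite s /\
                               hausdorff_measure s E = Finite 0).

(* Main.v *)
(** Fix [s < rho m / (beta + m + 1)] with [m = Mstar], and let [u = s (beta + m + 1) / m < rho].
    Near a large pole [a] of multiplicity [m], (KU4) shows that [f0] takes every value
    close to any other large pole [b], and that two points near [a] mapped near [b] are
    spread apart by a factor of at most [C |b|^(1 + 1/m) |a|^(beta/m)].  So every sequence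
    of large poles is followed by an orbit, and two orbits which follow the same poles
    [a_0, ..., a_(n-1)] and then separate start at a distance of at least about
    [C^(-n) |a_0 ... a_(n-1)|^(-(beta + m + 1)/m)].  As [sum |a|^(-u)] diverges, one may draw [a_n] from
    a finite set of poles over which [sum C^(-s) |a|^(-u) >= 2].  The weights
    [prod (C^(-s) |a_k|^(-u) / 2)] then define a mass distribution which excludes covers of small
    [s]-cost.  If these finite sets tend to infinity slowly enough, the gain [2^(-n)] absorbs
    the size of the last pole.  The points obtained escape; they are in the Julia set since
    pulling back along the orbit contracts, so that prepoles accumulate at them.

    No Cauchy theory is used: values are attained by minimising [|1/f - 1/v|] on a disc, or
    [|f - v| + lam |x - z|], because at a noncritical point these can be decreased. *)
Require Import Defs.
From Stdlib Require Import Reals List Lra Lia Wf_nat ClassicalEpsilon ClassicalDescription.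
From Coquelicot Require Import Coquelicot.
Open Scope R_scope.


(** * Choice and elementary estimates for the modulus *)

Lemma choice_function (A B : Type) (P : A -> B -> Prop) :
  (forall x, exists y, P x y) -> exists f, forall x, P x (f x).
Proof.
  intros H.
  exists (fun x => proj1_sig (constructive_indefinite_description _ (H x))).
  intros x; apply proj2_sig.
Qed.

Lemma Cmod_sub_sym (x y : C) : Cmod (x - y) = Cmod (y - x).
Proof. rewrite <- Cmod_opp. f_equal. ring. Qed.

Lemma Cmod_sub_triangle (x y z : C) :
  Cmod (x - z) <= Cmod (x - y) + Cmod (y - z).
Proof.
  replace (x - z)%C with ((x - y) + (y - z))%C by ring. apply Cmod_triangle.
Qed.

Lemma Cmod_sub_self (x : C) : Cmod (x - x) = 0.
Proof. replace (x - x)%C with (RtoC 0) by ring. apply Cmod_0. Qed.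

Lemma Cmod_le_sub (x y : C) : Cmod x <= Cmod (x - y) + Cmod y.
Proof.
  replace x with ((x - y) + y)%C at 1 by ring. apply Cmod_triangle.
Qed.

Lemma Cmod_sub_le (x y : C) : Cmod (x - y) <= Cmod x + Cmod y.
Proof.
  unfold Cminus. eapply Rle_trans; [apply Cmod_triangle|].
  rewrite Cmod_opp. lra.
Qed.

Lemma Cmod_sub_pos (x y : C) : x <> y -> 0 < Cmod (x - y).
Proof.
  intros H. apply Cmod_gt_0. intros E. apply H.
  replace x with ((x - y) + y)%C by ring. rewrite E. ring.
Qed.

Lemma Cmod_sub_pos_neq (x y : C) : 0 < Cmod (x - y) -> x <> y.
Proof. intros H E. rewrite E, Cmod_sub_self in H. lra. Qed.

Lemma Cmod_RtoC_mult (t : R) (z : C) : 0 <= t -> Cmod (RtoC t * z) = t * Cmod z.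
Proof. intros H. rewrite Cmod_mult, Cmod_R, Rabs_pos_eq; auto. Qed.

(** * Compactness of closed discs *)

Definition cluster (u : nat -> C) (l : C) : Prop :=
  forall eps, 0 < eps -> forall N, exists n, (N <= n)%nat /\ Cmod (u n - l) < eps.

Lemma real_cluster (u : nat -> R) (B : R) :
  (forall n, Rabs (u n) <= B) ->
  exists l, forall eps, 0 < eps -> forall N,
    exists n, (N <= n)%nat /\ Rabs (u n - l) < eps.
Proof.
  intros H.
  destruct (Bolzano_Weierstrass u _ (compact_P3 (- B) B)) as [l Hl].
  { intros n. apply Rabs_le_between, H. }
  exists l. intros eps He N.
  destruct (Hl (fun x => Rabs (x - l) < eps) N) as [p Hp].
  { exists (mkposreal eps He). intros x Hx. exact Hx. }
  exists p; exact Hp.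
Qed.

Lemma bounded_cluster (u : nat -> C) (B : R) :
  (forall n, Cmod (u n) <= B) -> exists l, cluster u l.
Proof.
  intros H.
  assert (Hc : forall n, Rabs (fst (u n)) <= B /\ Rabs (snd (u n)) <= B).
  { intros n. specialize (H n). pose proof (Rmax_Cmod (u n)).
    pose proof (Rmax_l (Rabs (fst (u n))) (Rabs (snd (u n)))).
    pose proof (Rmax_r (Rabs (fst (u n))) (Rabs (snd (u n)))). lra. }
  destruct (real_cluster (fun n => fst (u n)) B) as [x Hx].
  { intros n; apply Hc. }
  (* Along [phi] the first coordinate is within [1/(k+1)] of [x], so a cluster value of the second
     coordinate along [phi] gives a cluster point of [u]. *)
  destruct (choice_function nat nat
    (fun k n => (k <= n)%nat /\ Rabs (fst (u n) - x) < / (INR k + 1))) as [phi Hphi].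
  { intros k. apply Hx. apply Rinv_0_lt_compat. pose proof (pos_INR k). lra. }
  destruct (real_cluster (fun k => snd (u (phi k))) B) as [y Hy].
  { intros n; apply Hc. }
  exists (x, y). intros eps He N.
  destruct (nfloor_ex (3 / eps)) as [K0 [_ HK0]].
  { apply Rlt_le, Rdiv_lt_0_compat; lra. }
  destruct (Hy (eps / 3) ltac:(lra) (Nat.max N (S K0))) as [k [Hk1 Hk2]].
  exists (phi k). destruct (Hphi k) as [P1 P2]. split; [lia|].
  assert (Hkk : INR K0 + 1 <= INR k).
  { rewrite <- S_INR. apply le_INR. lia. }
  assert (Hsmall : / (INR k + 1) < eps / 3).
  { replace (eps / 3) with (/ (3 / eps)) by (field; lra).
    apply Rinv_lt_contravar; [|lra].
    apply Rmult_lt_0_compat; [apply Rdiv_lt_0_compat; lra|].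
    pose proof (pos_INR k); lra. }
  eapply Rle_lt_trans; [apply Cmod_2Rmax|]. simpl.
  assert (Rmax (Rabs (fst (u (phi k)) + - x)) (Rabs (snd (u (phi k)) + - y)) < eps / 3).
  { apply Rmax_lub_lt; unfold Rminus in *; lra. }
  assert (sqrt 2 < 2).
  { rewrite <- (sqrt_square 2) at 2 by lra. apply sqrt_lt_1; lra. }
  assert (0 <= Rmax (Rabs (fst (u (phi k)) + - x)) (Rabs (snd (u (phi k)) + - y))).
  { eapply Rle_trans; [apply Rabs_pos|apply Rmax_l]. }
  nra.
Qed.

Lemma cluster_in_disc (u : nat -> C) (l a : C) (r : R) (N : nat) :
  cluster u l -> (forall n, (N <= n)%nat -> Cmod (u n - a) <= r) -> Cmod (l - a) <= r.
Proof.
  intros Hl H. apply Rnot_lt_le. intros Hlt.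
  destruct (Hl (Cmod (l - a) - r) ltac:(lra) N) as [n [Hn1 Hn2]].
  specialize (H n Hn1). pose proof (Cmod_sub_triangle l (u n) a).
  rewrite (Cmod_sub_sym l (u n)) in H0. lra.
Qed.

(** A minimising sequence clusters in the disc, and lower semicontinuity relative to the disc bounds
    [h] at the cluster point by the infimum. The values are negated because completeness of the
    reals is stated for suprema. *)
Lemma disc_minimum (h : C -> R) (a : C) (r : R) :
  0 <= r -> (forall x, 0 <= h x) ->
  (forall x, Cmod (x - a) <= r -> forall eps, 0 < eps -> exists del, 0 < del /\
     forall y, Cmod (y - a) <= r -> Cmod (y - x) < del -> h x - eps < h y) ->
  exists x, Cmod (x - a) <= r /\ forall y, Cmod (y - a) <= r -> h x <= h y.
Proof.
  intros Hr Hpos Hlsc.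
  set (E := fun v => exists x, Cmod (x - a) <= r /\ v = - h x).
  destruct (completeness E) as [m [Hub Hlub]].
  { exists 0. intros v [x [_ ->]]. specialize (Hpos x). lra. }
  { exists (- h a), a. rewrite Cmod_sub_self. auto. }
  destruct (choice_function nat C
    (fun n x => Cmod (x - a) <= r /\ h x < - m + / (INR n + 1))) as [u Hu].
  { intros n. assert (Hp : 0 < / (INR n + 1)).
    { apply Rinv_0_lt_compat. pose proof (pos_INR n); lra. }
    apply NNPP. intros Hno.
    assert (m <= m - / (INR n + 1)); [|lra].
    apply Hlub. intros v [x [Hx ->]].
    apply Rnot_lt_le. intros Hlt. apply Hno. exists x. split; [auto|lra]. }
  destruct (bounded_cluster u (Cmod a + r)) as [l Hl].
  { intros n. pose proof (Cmod_le_sub (u n) a). destruct (Hu n). lra. }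
  assert (Hin : Cmod (l - a) <= r).
  { apply (cluster_in_disc u l a r 0); auto. intros n _; apply Hu. }
  exists l. split; [exact Hin|].
  assert (h l <= - m).
  { apply Rnot_lt_le. intros Hlt.
    destruct (Hlsc l Hin ((h l + m) / 2) ltac:(lra)) as [del [Hd Hdel]].
    destruct (nfloor_ex (2 / (h l + m))) as [K0 [_ HK0]].
    { apply Rlt_le, Rdiv_lt_0_compat; lra. }
    destruct (Hl del Hd (S K0)) as [n [Hn1 Hn2]].
    specialize (Hdel (u n) (proj1 (Hu n)) Hn2).
    destruct (Hu n) as [_ Hun].
    assert (/ (INR n + 1) < (h l + m) / 2).
    { replace ((h l + m) / 2) with (/ (2 / (h l + m))) by (field; lra).
      assert (INR K0 + 1 <= INR n) by (rewrite <- S_INR; apply le_INR; lia).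
      apply Rinv_lt_contravar; [|lra].
      apply Rmult_lt_0_compat; [apply Rdiv_lt_0_compat; lra|].
      pose proof (pos_INR n); lra. }
    lra. }
  intros y Hy. assert (- h y <= m) by (apply Hub; exists y; auto). lra.
Qed.

(** * Complex derivatives *)

Definition cont_at (h : C -> C) (z : C) : Prop :=
  forall eps, 0 < eps -> exists del, 0 < del /\
    forall y, Cmod (y - z) < del -> Cmod (h y - h z) < eps.

(** First order expansion with an explicit error term; the absence of a quotient lets [y = z] be
    included. *)
Definition differentiable_at (h : C -> C) (z d : C) : Prop :=
  forall eps, 0 < eps -> exists del, 0 < del /\
    forall y, Cmod (y - z) < del ->
      Cmod (h y - h z - d * (y - z)) <= eps * Cmod (y - z).

Lemma cderiv_differentiable (h : C -> C) (z d : C) :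
  cderiv h z d -> differentiable_at h z d.
Proof.
  intros [_ H] eps He.
  destruct (H z (fun P HP => HP) (mkposreal eps He)) as [del Hdel].
  exists del. split; [apply cond_pos|]. intros y Hy.
  specialize (Hdel y Hy). simpl in Hdel.
  replace (d * (y - z))%C with ((y - z) * d)%C by ring. exact Hdel.
Qed.

Lemma differentiable_cont (h : C -> C) (z d : C) :
  differentiable_at h z d -> cont_at h z.
Proof.
  intros H eps He. destruct (H 1 Rlt_0_1) as [del [Hd Hdel]].
  pose proof (Cmod_ge_0 d) as Hdd.
  exists (Rmin del (eps / (Cmod d + 1))).
  split; [apply Rmin_pos; auto; apply Rdiv_lt_0_compat; lra|].
  intros y Hy. specialize (Hdel y (Rlt_le_trans _ _ _ Hy (Rmin_l _ _))).
  pose proof (Rlt_le_trans _ _ _ Hy (Rmin_r _ _)) as Hy2.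
  apply Rlt_div_r in Hy2; [|lra].
  pose proof (Cmod_le_sub (h y - h z) (d * (y - z))) as Htri.
  rewrite Cmod_mult in Htri. lra.
Qed.

(* Move from [x0] in the direction [- (h x0 - v) / d]. *)
Lemma descent (h : C -> C) (x0 d v : C) (lam del0 : R) :
  differentiable_at h x0 d -> h x0 <> v -> 0 <= lam < Cmod d -> 0 < del0 ->
  exists x, Cmod (x - x0) < del0 /\
    Cmod (h x - v) + lam * Cmod (x - x0) < Cmod (h x0 - v).
Proof.
  intros Hd Hv [Hl0 Hl1] Hdel0.
  assert (Hd0 : d <> RtoC 0) by (apply Cmod_gt_0; lra).
  pose proof (Cmod_sub_pos _ _ Hv) as Hw.
  set (w := (h x0 - v)%C) in *.
  (* With a step of length [e/2], the linear part gains [|d| e/2], the penalty costs [lam e/2], and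
     the error at most half of the difference, so a net decrease remains. The factor [tau] is the
     fraction of [w] removed by this step, and [tau <= 1] keeps [1 - tau] nonnegative. *)
  destruct (Hd ((Cmod d - lam) / 2) ltac:(lra)) as [del [Hdel H]].
  set (e := Rmin (Rmin del del0) (Cmod w / Cmod d)).
  assert (He : 0 < e).
  { unfold e. repeat apply Rmin_pos; auto. apply Rdiv_lt_0_compat; lra. }
  set (tau := e / 2 * (Cmod d / Cmod w)).
  assert (Hr : 0 < Cmod d / Cmod w) by (apply Rdiv_lt_0_compat; lra).
  assert (Htau : 0 < tau) by (apply Rmult_lt_0_compat; lra).
  assert (Htau1 : tau <= 1).
  { unfold tau. assert (He2 : e <= Cmod w / Cmod d) by apply Rmin_r.
    assert (Cmod w / Cmod d * (Cmod d / Cmod w) = 1) by (field; lra). nra. }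
  set (x := (x0 - RtoC tau * (w / d))%C).
  assert (Hx : Cmod (x - x0) = e / 2).
  { replace (x - x0)%C with (- (RtoC tau * (w / d)))%C by (unfold x; ring).
    rewrite Cmod_opp, Cmod_RtoC_mult, Cmod_div by (auto; lra).
    unfold tau. field. lra. }
  exists x.
  assert (e <= del /\ e <= del0).
  { unfold e. pose proof (Rmin_l (Rmin del del0) (Cmod w / Cmod d)).
    pose proof (Rmin_l del del0). pose proof (Rmin_r del del0). lra. }
  split; [lra|].
  specialize (H x ltac:(lra)).
  assert (Hsplit : (h x - v = (h x - h x0 - d * (x - x0)) + RtoC (1 - tau) * w)%C).
  { unfold x, w. rewrite RtoC_minus. field. auto. }
  rewrite Hsplit.
  pose proof (Cmod_triangle (h x - h x0 - d * (x - x0)) (RtoC (1 - tau) * w)) as Ht.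
  rewrite (Cmod_RtoC_mult (1 - tau)) in Ht by lra.
  assert (Htw : tau * Cmod w = Cmod d * (e / 2)) by (unfold tau; field; lra).
  rewrite Hx in *. nra.
Qed.

(* The minimiser of [|h x - v| + lam |x - z|] solves [h x = v], since otherwise
   moving along the descent direction would decrease this quantity. *)
Lemma lift_value (h : C -> C) (z v : C) (r lam : R) :
  0 < r -> 0 < lam ->
  (forall x, Cmod (x - z) <= r -> exists d, differentiable_at h x d /\ lam < Cmod d) ->
  Cmod (h z - v) < lam * r ->
  exists x, Cmod (x - z) <= r /\ h x = v /\ lam * Cmod (x - z) <= Cmod (h z - v).
Proof.
  intros Hr Hlam Hdiff Hv.
  destruct (disc_minimum (fun x => Cmod (h x - v) + lam * Cmod (x - z)) z r)
    as [x [Hx Hmin]].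
  - lra.
  - intros x. pose proof (Cmod_ge_0 (h x - v)). pose proof (Cmod_ge_0 (x - z)). nra.
  - intros x Hx eps He. destruct (Hdiff x Hx) as [d [Hd _]].
    destruct (differentiable_cont _ _ _ Hd (eps / 2) ltac:(lra)) as [del [Hdel H]].
    exists (Rmin del (eps / (2 * lam))).
    split; [apply Rmin_pos; auto; apply Rdiv_lt_0_compat; lra|].
    intros y _ Hy. specialize (H y (Rlt_le_trans _ _ _ Hy (Rmin_l _ _))).
    pose proof (Rlt_le_trans _ _ _ Hy (Rmin_r _ _)) as Hy2.
    apply Rlt_div_r in Hy2; [|lra].
    pose proof (Cmod_sub_triangle (h x) (h y) v) as T1.
    rewrite (Cmod_sub_sym (h x) (h y)) in T1.
    pose proof (Cmod_sub_triangle x y z) as T2.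
    rewrite (Cmod_sub_sym x y) in T2.
    apply (Rmult_le_compat_l lam) in T2; lra.
  - pose proof (Hmin z ltac:(rewrite Cmod_sub_self; lra)) as Hz.
    rewrite Cmod_sub_self in Hz.
    pose proof (Cmod_ge_0 (h x - v)) as P1.
    (* Comparison with the centre gives [lam |x - z| <= |h z - v| < lam r]: the minimiser is
       interior, so a descent step can stay inside the disc. *)
    assert (Hlt : Cmod (x - z) < r) by nra.
    exists x. split; [lra|]. split; [|lra].
    apply NNPP. intros Hne.
    destruct (Hdiff x Hx) as [d [Hd Hld]].
    destruct (descent h x d v lam (r - Cmod (x - z)) Hd Hne ltac:(lra) ltac:(lra))
      as [y [Hy1 Hy2]].
    pose proof (Cmod_sub_triangle y x z) as T.
    specialize (Hmin y ltac:(lra)). nra.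
Qed.

Lemma differentiable_inv (h : C -> C) (z d : C) :
  differentiable_at h z d -> h z <> RtoC 0 ->
  differentiable_at (fun x => / h x)%C z (- (d / (h z * h z)))%C.
Proof.
  intros Hd Hz eps He.
  assert (Hm : 0 < Cmod (h z)) by (apply Cmod_gt_0; auto).
  set (H := Cmod (h z)) in *.
  pose proof (Cmod_ge_0 d) as Hdd.
  (* [1/h y - 1/h z + d (y - z)/h(z)^2 = (d(y-z)(h y - h z) - h z E)/(h y h(z)^2)]
     where [E] is the first order error of [h] *)
  set (e1 := Rmin (eps * (H * H) / 4) 1).
  assert (HH : 0 < H * H) by (apply Rmult_lt_0_compat; auto).
  assert (HeH : 0 < eps * (H * H)) by (apply Rmult_lt_0_compat; auto).
  assert (He1 : 0 < e1) by (apply Rmin_pos; lra).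
  set (e2 := Rmin (H / 2) (eps * (H * H * H) / (4 * (Cmod d + 1)))).
  assert (He2 : 0 < e2).
  { apply Rmin_pos; [lra|]. apply Rdiv_lt_0_compat; [|lra].
    apply Rmult_lt_0_compat; [auto|]. apply Rmult_lt_0_compat; auto. }
  destruct (Hd e1 He1) as [del1 [Hdel1 H1]].
  destruct (differentiable_cont _ _ _ Hd e2 He2) as [del2 [Hdel2 H2]].
  exists (Rmin del1 del2). split; [apply Rmin_pos; auto|].
  intros y Hy.
  specialize (H1 y (Rlt_le_trans _ _ _ Hy (Rmin_l _ _))).
  specialize (H2 y (Rlt_le_trans _ _ _ Hy (Rmin_r _ _))).
  set (E := (h y - h z - d * (y - z))%C) in *.
  set (D := (h y - h z)%C) in *.
  assert (Hhy : H / 2 <= Cmod (h y)).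
  { pose proof (Cmod_le_sub (h z) (h y)) as T. rewrite Cmod_sub_sym in T.
    fold D H in T. pose proof (Rmin_l (H / 2) (eps * (H * H * H) / (4 * (Cmod d + 1)))).
    fold e2 in H0. lra. }
  assert (Hy0 : h y <> RtoC 0) by (apply Cmod_gt_0; lra).
  replace (/ h y - / h z - - (d / (h z * h z)) * (y - z))%C
    with ((d * (y - z) * D - h z * E) / (h y * (h z * h z)))%C
    by (unfold E, D; field; auto).
  rewrite Cmod_div by (repeat apply Cmult_neq_0; auto).
  rewrite !Cmod_mult. fold H.
  assert (Hnum : Cmod (d * (y - z) * D - h z * E) <=
                 Cmod d * Cmod (y - z) * Cmod D + H * Cmod E).
  { eapply Rle_trans; [apply Cmod_sub_le|]. rewrite !Cmod_mult. fold H. lra. }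
  set (t := Cmod (y - z)) in *. pose proof (Cmod_ge_0 (y - z)) as Ht. fold t in Ht.
  assert (B1 : Cmod d * Cmod D <= eps * (H * H * H) / 4).
  { assert (e2 <= eps * (H * H * H) / (4 * (Cmod d + 1))) by apply Rmin_r.
    assert (eps * (H * H * H) / (4 * (Cmod d + 1)) * (Cmod d + 1) = eps * (H * H * H) / 4)
      by (field; lra).
    pose proof (Cmod_ge_0 D). nra. }
  assert (B2 : Cmod E <= eps * (H * H) / 4 * t).
  { assert (e1 <= eps * (H * H) / 4) by apply Rmin_l. nra. }
  (* Each of the two terms of the numerator is at most [eps H^3 t / 4]; their sum is
     [eps t H^2 (H/2)], and [H/2 <= |h y|]. *)
  apply Rle_div_l; [apply Rmult_lt_0_compat; nra|].
  assert (B4 : Cmod d * t * Cmod D <= eps * (H * H * H) / 4 * t) by nra.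
  assert (B5 : H * Cmod E <= eps * (H * H * H) / 4 * t) by nra.
  assert (B6 : eps * t * (H * H * (H / 2)) <= eps * t * (H * H * Cmod (h y))).
  { apply Rmult_le_compat_l; [apply Rmult_le_pos; lra|].
    apply Rmult_le_compat_l; lra. }
  nra.
Qed.

(** An argument of [w] is [acos] of its real part, with the sign of its imaginary part; de Moivre's
    formula then gives the root. This serves to choose a direction of approach to a pole of order
    [m]. *)
Lemma complex_root (w : C) (m : nat) :
  (1 <= m)%nat -> Cmod w = 1 -> exists zeta : C, Cmod zeta = 1 /\ (zeta ^ m = w)%C.
Proof.
  intros Hm Hw.
  assert (Hpol : exists th, w = (cos th, sin th)).
  { destruct w as [x y]. unfold Cmod in Hw; simpl in Hw.
    assert (Hxy : x * x + y * y = 1).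
    { replace (x * x + y * y) with (x * (x * 1) + y * (y * 1)) by ring.
      rewrite <- (sqrt_sqrt (x * (x * 1) + y * (y * 1))) by nra. rewrite Hw. ring. }
    assert (-1 <= x <= 1) by nra.
    assert (Hs : sin (acos x) = Rabs y).
    { rewrite sin_acos by auto. unfold Rsqr. replace (1 - x * x) with (Rsqr y)
        by (unfold Rsqr; lra). apply sqrt_Rsqr_abs. }
    destruct (Rle_dec 0 y).
    - exists (acos x). rewrite cos_acos, Hs, Rabs_pos_eq; auto.
    - exists (- acos x). rewrite cos_neg, sin_neg, cos_acos, Hs, Rabs_left by lra.
      f_equal; ring. }
  destruct Hpol as [th ->].
  assert (HM : 0 < INR m) by (apply lt_0_INR; lia).
  assert (Hmod : forall t, Cmod (cos t, sin t) = 1).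
  { intros t. unfold Cmod; simpl. transitivity (sqrt 1); [f_equal|apply sqrt_1].
    pose proof (sin2_cos2 t). unfold Rsqr in H. lra. }
  exists (cos (th / INR m), sin (th / INR m)). split; [apply Hmod|].
  assert (Hpow : forall (t : R) k, Cpow (cos t, sin t) k = (cos (INR k * t), sin (INR k * t))).
  { intros t k. induction k.
    - simpl. rewrite Rmult_0_l, cos_0, sin_0. reflexivity.
    - rewrite S_INR. replace ((INR k + 1) * t) with (t + INR k * t) by ring.
      rewrite cos_plus, sin_plus. simpl Cpow. rewrite IHk. unfold Cmult; simpl.
      f_equal. ring. }
  rewrite Hpow. replace (INR m * (th / INR m)) with th by (field; lra). reflexivity.
Qed.

Lemma pow_n_Cpow (z : C) (k : nat) : @pow_n C_Ring z k = (z ^ k)%C.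
Proof. induction k; simpl; [reflexivity|]. rewrite IHk. reflexivity. Qed.

(** The mean value theorem fails for complex values, so it is applied to the real function
    [Re (conj w h)] along the segment, with [w = h y - h x]. Its increment is [|w|^2] and its
    derivative is at most [|w| B |y - x|]; one factor [|w|] cancels. *)
Lemma Cmod_MVT (h : C -> C) (x y : C) (B : R) :
  (forall t, 0 <= t <= 1 ->
     exists d, differentiable_at h (x + RtoC t * (y - x))%C d /\ Cmod d <= B) ->
  Cmod (h y - h x) <= B * Cmod (y - x).
Proof.
  intros Hd.
  destruct (Req_dec (Cmod (h y - h x)) 0) as [E|E].
  { rewrite E. destruct (Hd 0 ltac:(lra)) as [d [_ Hb]].
    pose proof (Cmod_ge_0 d). pose proof (Cmod_ge_0 (y - x)). nra. }
  set (w := (h y - h x)%C) in *.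
  pose proof (Cmod_ge_0 w) as Hw.
  set (g := fun t : R => Re (Cconj w * h (x + RtoC t * (y - x)))%C).
  destruct (choice_function R C (fun t d => 0 <= t <= 1 ->
     differentiable_at h (x + RtoC t * (y - x))%C d /\ Cmod d <= B)) as [D HD].
  { intros t. destruct (excluded_middle_informative (0 <= t <= 1)) as [Ht|Ht].
    - destruct (Hd t Ht) as [d Hdd]. exists d; auto.
    - exists (RtoC 0). tauto. }
  assert (Hg : forall t, 0 <= t <= 1 ->
    derivable_pt_lim g t (Re (Cconj w * (D t * (y - x)))%C)).
  { intros t Ht eps He. destruct (HD t Ht) as [HDt _].
    set (k := Cmod w * Cmod (y - x) + 1).
    assert (Hk : 0 < k).
    { unfold k. pose proof (Cmod_ge_0 (y - x)). nra. }
    destruct (HDt (eps / k / 2)) as [del [Hdel H]].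
    { apply Rdiv_lt_0_compat; [|lra]. apply Rdiv_lt_0_compat; lra. }
    pose proof (Cmod_ge_0 (y - x)) as Hyx.
    assert (Hdp : 0 < del / (Cmod (y - x) + 1)) by (apply Rdiv_lt_0_compat; lra).
    exists (mkposreal _ Hdp). intros s Hs0 Hs. simpl in Hs.
    apply Rlt_div_r in Hs; [|lra].
    assert (Hst : ((x + RtoC (t + s) * (y - x)) - (x + RtoC t * (y - x)) = RtoC s * (y - x))%C).
    { rewrite RtoC_plus. ring. }
    specialize (H (x + RtoC (t + s) * (y - x))%C).
    rewrite Hst in H. rewrite Cmod_mult, Cmod_R in H.
    pose proof (Rabs_pos_lt s Hs0) as Hs1.
    specialize (H ltac:(nra)).
    set (Er := (h (x + RtoC (t + s) * (y - x)) - h (x + RtoC t * (y - x)) -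
                D t * (RtoC s * (y - x)))%C) in *.
    assert (Hq : (g (t + s) - g t) / s - Re (Cconj w * (D t * (y - x))) =
                 Re (Cconj w * Er)%C / s).
    { assert (Hre : (Cconj w * Er = Cconj w * h (x + RtoC (t + s) * (y - x)) -
          Cconj w * h (x + RtoC t * (y - x)) - RtoC s * (Cconj w * (D t * (y - x))))%C).
      { unfold Er. ring. }
      rewrite Hre. unfold g.
      set (A1 := (Cconj w * h (x + RtoC (t + s) * (y - x)))%C).
      set (A2 := (Cconj w * h (x + RtoC t * (y - x)))%C).
      set (A3 := (Cconj w * (D t * (y - x)))%C).
      unfold Re, Cminus, Cplus, Cmult, Copp, RtoC; simpl. field. auto. }
    rewrite Hq, Rabs_div by auto.
    apply Rlt_div_l; [auto|].
    eapply Rle_lt_trans; [apply re_le_Cmod|].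
    rewrite Cmod_mult, Cmod_conj.
    assert (Cmod w * Cmod Er <= Cmod w * (eps / k / 2 * (Rabs s * Cmod (y - x))))
      by (apply Rmult_le_compat_l; auto).
    assert (Hfin : Cmod w * Cmod (y - x) * (eps / k / 2) < eps).
    { assert (eps / k / 2 * k = eps / 2) by (field; lra).
      assert (0 < eps / k / 2) by (apply Rdiv_lt_0_compat; [apply Rdiv_lt_0_compat|]; lra).
      unfold k in *. nra. }
    nra. }
  destruct (MVT_cor2 g (fun t => Re (Cconj w * (D t * (y - x)))%C) 0 1 Rlt_0_1 Hg)
    as [c [Hc1 Hc2]].
  assert (Hend : g 1 - g 0 = Cmod w * Cmod w).
  { unfold g. replace (x + RtoC 1 * (y - x))%C with y by ring.
    replace (x + RtoC 0 * (y - x))%C with x by ring.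
    assert (Hq : Re (Cconj w * h y) - Re (Cconj w * h x) = Re (Cconj w * w)).
    { unfold w at 3. unfold Re, Cconj, Cminus, Cplus, Cmult, Copp; simpl. ring. }
    rewrite Hq. replace (Cmod w * Cmod w) with (Cmod w ^ 2) by ring.
    rewrite Cmod2_alt. destruct w as [p q]. unfold Re, Im, Cconj, Cmult; simpl. ring. }
  rewrite Hend, Rminus_0_r, Rmult_1_r in Hc1.
  destruct (HD c ltac:(lra)) as [_ HDc].
  pose proof (re_le_Cmod (Cconj w * (D c * (y - x)))) as T.
  rewrite <- Hc1, !Cmod_mult, Cmod_conj, Rabs_pos_eq in T by nra.
  pose proof (Cmod_ge_0 (y - x)).
  apply Rmult_le_reg_l with (Cmod w); [lra|].
  eapply Rle_trans; [exact T|].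
  apply Rmult_le_compat_l; [lra|]. apply Rmult_le_compat_r; lra.
Qed.


(** * Mass distribution on trees *)

Definition lsum {A : Type} (w : A -> R) (l : list A) : R :=
  fold_right Rplus 0 (map w l).

Definition agree {A : Type} (n : nat) (x y : nat -> A) : Prop :=
  forall k, (k < n)%nat -> x k = y k.

(** The mass of the cylinder of all sequences sharing their first [n] entries with [x]. *)
Fixpoint weight {A : Type} (w : A -> R) (x : nat -> A) (n : nat) : R :=
  match n with O => 1 | S k => weight w x k * w (x k) end.

Definition charge (P : Prop) (v : R) : R :=
  if excluded_middle_informative P then v else 0.

Lemma charge_true (P : Prop) (v : R) : P -> charge P v = v.
Proof. intros H. unfold charge. destruct excluded_middle_informative; tauto. Qed.

Lemma charge_false (P : Prop) (v : R) : ~ P -> charge P v = 0.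
Proof. intros H. unfold charge. destruct excluded_middle_informative; tauto. Qed.

Lemma charge_nonneg (P : Prop) (v : R) : 0 <= v -> 0 <= charge P v.
Proof. intros H. unfold charge. destruct excluded_middle_informative; lra. Qed.

Lemma charge_mono (P Q : Prop) (u v : R) :
  0 <= u -> 0 <= v -> (P -> Q /\ u <= v) -> charge P u <= charge Q v.
Proof.
  intros Hu Hv H. unfold charge.
  destruct (excluded_middle_informative P) as [p|p];
  destruct (excluded_middle_informative Q) as [q|q]; try lra; tauto.
Qed.

Lemma lsum_nonneg {A} (w : A -> R) l : (forall a, In a l -> 0 <= w a) -> 0 <= lsum w l.
Proof.
  induction l as [|a l IH]; intros H; unfold lsum; simpl; [lra|].
  fold (lsum w l). pose proof (H a (or_introl eq_refl)).
  assert (0 <= lsum w l) by (apply IH; intros; apply H; right; auto). lra.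
Qed.

Lemma lsum_mono {A} (v w : A -> R) l :
  (forall a, In a l -> v a <= w a) -> lsum v l <= lsum w l.
Proof.
  induction l as [|a l IH]; intros H; unfold lsum; simpl; [lra|].
  fold (lsum v l) (lsum w l). pose proof (H a (or_introl eq_refl)).
  assert (lsum v l <= lsum w l) by (apply IH; intros; apply H; right; auto). lra.
Qed.

Lemma lsum_scal {A} (c : R) (w : A -> R) l :
  lsum (fun a => c * w a) l = c * lsum w l.
Proof.
  unfold lsum. induction l as [|a l IH]; simpl; [lra|]. rewrite IH. ring.
Qed.

Lemma lsum_plus {A} (v w : A -> R) l :
  lsum (fun a => v a + w a) l = lsum v l + lsum w l.
Proof.
  unfold lsum. induction l as [|a l IH]; simpl; [lra|]. rewrite IH. ring.
Qed.

(** At most one entry of a duplicate-free list satisfies [P], so at most one term is nonzero. In the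
    tree: a cylinder below a node lies below at most one of its children. *)
Lemma lsum_charge_le {A} (P : A -> Prop) (Q : Prop) (v : R) (l : list A) :
  NoDup l -> 0 <= v -> (forall a, P a -> Q) -> (forall a b, P a -> P b -> a = b) ->
  lsum (fun a => charge (P a) v) l <= charge Q v.
Proof.
  intros Hnd Hv HQ Huniq. induction Hnd as [|a l Ha Hnd IH]; unfold lsum; simpl.
  - apply charge_nonneg; auto.
  - fold (lsum (fun a => charge (P a) v) l).
    destruct (excluded_middle_informative (P a)) as [p|p].
    + assert (Hz : lsum (fun a => charge (P a) v) l <= lsum (fun _ => 0 * 0) l).
      { apply lsum_mono. intros b Hb. rewrite charge_false; [lra|].
        intros Pb. apply Ha. rewrite (Huniq a b p Pb). auto. }
      rewrite lsum_scal, Rmult_0_l in Hz.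
      rewrite !charge_true; eauto. lra.
    + rewrite charge_false by auto. lra.
Qed.

Lemma sum_f_R0_mono (u v : nat -> R) N :
  (forall i, u i <= v i) -> sum_f_R0 u N <= sum_f_R0 v N.
Proof. intros H. apply sum_Rle. auto. Qed.

Lemma lsum_sum_f_R0 {A} (u : A -> nat -> R) l N :
  lsum (fun a => sum_f_R0 (u a) N) l = sum_f_R0 (fun i => lsum (fun a => u a i) l) N.
Proof.
  induction N as [|N IH]; simpl; [reflexivity|].
  rewrite lsum_plus, IH. reflexivity.
Qed.

Lemma sum_f_R0_grow (u : nat -> R) N N' :
  (forall i, 0 <= u i) -> (N <= N')%nat -> sum_f_R0 u N <= sum_f_R0 u N'.
Proof.
  intros H HN. induction HN; [lra|]. simpl. pose proof (H (S m)). lra.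
Qed.

Lemma sum_f_R0_term (u : nat -> R) N :
  (forall i, 0 <= u i) -> u N <= sum_f_R0 u N.
Proof.
  intros H. destruct N; simpl; [lra|]. pose proof (cond_pos_sum u N H). lra.
Qed.

Lemma weight_agree {A} (w : A -> R) x y n :
  agree n x y -> weight w x n = weight w y n.
Proof.
  induction n as [|n IH]; intros H; simpl; [reflexivity|].
  rewrite IH, (H n) by (try lia; intros k Hk; apply H; lia). reflexivity.
Qed.

Lemma weight_pos {A} (w : A -> R) x n : (forall a, 0 < w a) -> 0 < weight w x n.
Proof.
  intros H. induction n; simpl; [lra|]. apply Rmult_lt_0_compat; auto.
Qed.

(* Descend the tree, keeping the total weight of the cylinders inside the current
   node below [theta] times the weight of the node. *)
Lemma avoiding_word {A} (T : nat -> list A) (w : A -> R) (act : nat -> Prop)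
  (om : nat -> nat -> A) (len : nat -> nat) (theta : R) :
  (forall a, 0 < w a) -> (forall n, NoDup (T n)) -> (forall n, 1 <= lsum w (T n)) ->
  0 <= theta < 1 ->
  (forall N, sum_f_R0 (fun i => charge (act i) (weight w (om i) (len i))) N <= theta) ->
  exists x, (forall k, In (x k) (T k)) /\
    forall i, act i -> ~ agree (len i) (om i) x.
Proof.
  intros Hw Hnd Hsum Hth Hcost.
  assert (Hwt : forall x n, 0 <= weight w x n)
    by (intros x n; apply Rlt_le, weight_pos; auto).
  set (inside := fun (x : nat -> A) n i => act i /\ (n <= len i)%nat /\ agree n (om i) x).
  set (mass := fun x n N =>
    sum_f_R0 (fun i => charge (inside x n i) (weight w (om i) (len i))) N).
  set (good := fun x n => forall N, mass x n N <= theta * weight w x n).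
  set (upd := fun (x : nat -> A) (n : nat) (a : A) k => if Nat.eqb k n then a else x k).
  assert (Hupd : forall x n a, agree n (upd x n a) x).
  { intros x n a k Hk. unfold upd. destruct (Nat.eqb_spec k n); [lia|reflexivity]. }
  assert (Hupd1 : forall x n a, upd x n a n = a).
  { intros x n a. unfold upd. rewrite Nat.eqb_refl. reflexivity. }
  (* If every child violated the bound, summing over the children, whose weights add up to at least
     the weight of the node, would violate it at the node. *)
  assert (Hstep : forall x n, good x n -> exists a, In a (T n) /\ good (upd x n a) (S n)).
  { intros x n Hg. apply NNPP. intros Hno.
    assert (Hbad : forall a, In a (T n) -> exists N,
      theta * weight w x n * w a < mass (upd x n a) (S n) N).
    { intros a Ha. apply NNPP. intros Hno2. apply Hno. exists a. split; auto.
      intros N. apply Rnot_lt_le. intros Hlt. apply Hno2. exists N.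
      simpl in Hlt. rewrite Hupd1, (weight_agree w _ x n (Hupd x n a)) in Hlt. lra. }
    (* There are finitely many children and partial sums increase, so one [N] serves all of them. *)
    assert (Hall : exists N, forall a, In a (T n) ->
      theta * weight w x n * w a < mass (upd x n a) (S n) N).
    { clear Hno. induction (T n) as [|a l IH].
      - exists O. intros a [].
      - destruct IH as [N1 H1]; [intros; apply Hbad; right; auto|].
        destruct (Hbad a (or_introl eq_refl)) as [N2 H2].
        exists (Nat.max N1 N2).
        assert (Hmon : forall b N N', (N <= N')%nat ->
           mass (upd x n b) (S n) N <= mass (upd x n b) (S n) N').
        { intros b N N' HN. apply sum_f_R0_grow; auto.
          intros i. apply charge_nonneg; auto. }
        intros b [<-|Hb].
        + eapply Rlt_le_trans; [exact H2|]. apply Hmon; lia.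
        + eapply Rlt_le_trans; [apply H1; auto|]. apply Hmon; lia. }
    destruct Hall as [N HN].
    assert (Hle : lsum (fun a => mass (upd x n a) (S n) N) (T n) <= mass x n N).
    { unfold mass. rewrite lsum_sum_f_R0. apply sum_f_R0_mono. intros i.
      apply lsum_charge_le; auto.
      - intros a [Ha [Hl Hag]]. split; [auto|]. split; [lia|].
        intros k Hk. rewrite (Hag k) by lia. apply Hupd; auto.
      - intros a b [_ [_ Ha]] [_ [_ Hb]].
        rewrite <- (Hupd1 x n a), <- (Hupd1 x n b), <- (Ha n), <- (Hb n) by lia.
        reflexivity. }
    assert (Hlt : theta * weight w x n * lsum w (T n) <
                  lsum (fun a => mass (upd x n a) (S n) N) (T n)).
    { rewrite <- lsum_scal.
      pose proof (Hsum n) as Hs.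
      clear Hle Hbad Hno. destruct (T n) as [|a l].
      - unfold lsum in Hs; simpl in Hs; lra.
      - unfold lsum; simpl. apply Rplus_lt_le_compat.
        + apply HN; left; auto.
        + apply (lsum_mono (fun a => theta * weight w x n * w a)).
          intros b Hb. apply Rlt_le, HN; right; auto. }
    pose proof (Hg N). pose proof (Hsum n). pose proof (Hwt x n).
    assert (0 <= theta * weight w x n) by (apply Rmult_le_pos; lra).
    assert (theta * weight w x n * 1 <= theta * weight w x n * lsum w (T n))
      by (apply Rmult_le_compat_l; auto).
    lra. }
  assert (Hne : exists a : A, True).
  { pose proof (Hsum O) as Hs. destruct (T O) as [|a l].
    - unfold lsum in Hs; simpl in Hs; lra.
    - exists a; auto. }
  destruct Hne as [a0 _].
  destruct (choice_function ((nat -> A) * nat) A (fun p a => good (fst p) (snd p) ->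
     In a (T (snd p)) /\ good (upd (fst p) (snd p) a) (S (snd p)))) as [f Hf].
  { intros [x n]; simpl.
    destruct (excluded_middle_informative (good x n)) as [g|g].
    - destruct (Hstep x n g) as [a Ha]. exists a; auto.
    - exists a0; tauto. }
  (* The step from [k] to [k + 1] changes only entry [k], so the diagonal sequence agrees with [X n]
     on the first [n] entries; the default [a0] survives only beyond them. *)
  set (X := fix X n := match n with
     | O => fun _ => a0 | S k => upd (X k) k (f (X k, k)) end).
  assert (HX : forall n, good (X n) n).
  { induction n as [|n IH].
    - intros N. simpl. rewrite Rmult_1_r. eapply Rle_trans; [|apply (Hcost N)].
      apply sum_f_R0_mono. intros i. apply charge_mono; auto.
      intros [Ha _]; split; auto; lra.
    - apply (Hf (X n, n) IH). }
  exists (fun k => X (S k) k). split.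
  - intros k. simpl. rewrite Hupd1. apply (Hf (X k, k) (HX k)).
  - assert (Hag : forall n, agree n (X n) (fun k => X (S k) k)).
    { induction n as [|n IH]; intros k Hk; [lia|].
      destruct (Nat.eq_dec k n) as [->|Hkn]; [reflexivity|].
      transitivity (X n k); [apply Hupd; lia|apply IH; lia]. }
    intros i Hi Hai.
    (* If the sequence entered cylinder [i], its node of depth [len i] would be that cylinder,
       containing all of its own weight, against the bound [theta < 1]. *)
    pose proof (HX (len i) i) as Hg.
    assert (Hag' : agree (len i) (om i) (X (len i))).
    { intros k Hk. rewrite (Hai k Hk). symmetry. apply (Hag (len i) k Hk). }
    assert (Hin : weight w (om i) (len i) <= mass (X (len i)) (len i) i).
    { rewrite <- (charge_true (inside (X (len i)) (len i) i) (weight w (om i) (len i))).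
      - apply (sum_f_R0_term (fun i0 => charge (inside (X (len i)) (len i) i0)
           (weight w (om i0) (len i0)))).
        intros j; apply charge_nonneg; auto.
      - repeat split; auto. }
    rewrite <- (weight_agree w _ _ _ Hag') in Hg.
    pose proof (weight_pos w (om i) (len i) Hw). nra.
Qed.

(** * Mass distribution principle for Hausdorff measure *)

Lemma least_witness (P : nat -> Prop) :
  (exists n, P n) -> exists n, P n /\ forall k, (k < n)%nat -> ~ P k.
Proof.
  intros [n Hn]. revert Hn. induction n as [n IH] using (well_founded_induction Wf_nat.lt_wf).
  intros Hn. destruct (classic (exists k, (k < n)%nat /\ P k)) as [[k [Hk Pk]]|H].
  - exact (IH k Hk Pk).
  - exists n. split; auto. intros k Hk Pk. apply H. exists k; auto.
Qed.

Lemma weight_le_half_pow {A} (w : A -> R) x n :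
  (forall a, 0 < w a) -> (forall k, w (x k) <= / 2) -> weight w x n <= (/ 2) ^ n.
Proof.
  intros Hw H. induction n as [|n IH]; simpl; [lra|].
  rewrite (Rmult_comm (/ 2)). apply Rmult_le_compat; auto.
  - apply Rlt_le, weight_pos; auto.
  - apply Rlt_le, Hw.
Qed.

(** Each set of a cover that meets coded points is replaced by a cylinder containing all their
    codes, of weight at most [(K + 1) r^s]. A cover of small cost then yields cylinders of total
    weight at most [1/2]; a sequence avoiding them codes a point of [E] that no set covers. *)
Lemma hausdorff_measure_neq_0 {A} (E : C -> Prop) (T : nat -> list A) (w : A -> R)
  (code : (nat -> A) -> C -> Prop) (s K : R) :
  0 <= K ->
  (forall a, 0 < w a) -> (forall n a, In a (T n) -> w a <= / 2) ->
  (forall n, NoDup (T n)) -> (forall n, 1 <= lsum w (T n)) ->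
  (forall x, (forall k, In (x k) (T k)) -> exists z, E z /\ code x z) ->
  (forall x y n z z' r, (forall k, In (x k) (T k)) -> (forall k, In (y k) (T k)) ->
     agree n x y -> x n <> y n -> code x z -> code y z' ->
     0 < r -> Cmod (z - z') <= r -> weight w x n <= K * Rpower r s) ->
  hausdorff_measure s E <> Finite 0.
Proof.
  intros HK Hw Hhalf Hnd Hsum Hex Hsep Hmeas.
  set (eta := / (2 * (K + 1))).
  assert (Heta : 0 < eta) by (apply Rinv_0_lt_compat; lra).
  (* The measure is a supremum of contents, so if it vanishes the content at scale [1] is at most
     [0], and some cover costs less than [eta]. *)
  assert (Hcov : exists (U : nat -> C -> Prop) (r : nat -> R),
     (forall i, 0 < r i <= 1 /\ diam_le (U i) (r i)) /\
     (forall z, E z -> exists i, U i z) /\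
     Rbar_lt (cover_cost U r s) eta).
  { apply NNPP. intros Hno.
    assert (Hc : Rbar_le eta (hausdorff_content s 1 E)).
    { unfold hausdorff_content, Rbar_glb.
      destruct Rbar_ex_glb as [g [Hg0 Hg]]; cbn [proj1_sig]. apply Hg.
      intros x [U [r [H1 [H2 ->]]]]. apply Rbar_not_lt_le. intros Hlt.
      apply Hno. exists U, r. auto. }
    assert (Hm : Rbar_le (hausdorff_content s 1 E) (hausdorff_measure s E)).
    { unfold hausdorff_measure, Rbar_lub.
      destruct Rbar_ex_lub as [g [Hg Hg0]]; cbn [proj1_sig]. apply Hg. exists 1. split; [lra|auto]. }
    rewrite Hmeas in Hm. pose proof (Rbar_le_trans _ _ _ Hc Hm) as Hbad.
    simpl in Hbad. lra. }
  destruct Hcov as [U [r [Hr [Hcover Hcost]]]].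
  set (act := fun i => exists x z, (forall k, In (x k) (T k)) /\ code x z /\ U i z).
  destruct (choice_function nat ((nat -> A) * nat) (fun i p => act i ->
    weight w (fst p) (snd p) <= (K + 1) * Rpower (r i) s /\
    forall x z, (forall k, In (x k) (T k)) -> code x z -> U i z ->
      agree (snd p) (fst p) x)) as [f Hf].
  { intros i. destruct (excluded_middle_informative (act i)) as [Ha|Ha].
    (* Sets without coded points receive an arbitrary word, which needs only one letter. *)
    2:{ destruct (T O) as [|a l] eqn:E0.
        - pose proof (Hsum O) as H0. rewrite E0 in H0. unfold lsum in H0; simpl in H0; lra.
        - exists ((fun _ => a), O). tauto. }
    destruct Ha as [x [z [Hx [Hz Uz]]]].
    assert (HR : 0 < Rpower (r i) s) by apply exp_pos.
    (* Either two codes in the set separate, and the cylinder is cut at the first index where some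
       code differs from [x], so that the separation hypothesis bounds its weight; or there is a
       single code, and a cylinder deep enough to have weight below [r^s] is taken. The constant
       [K + 1] covers both cases. *)
    destruct (classic (exists n, exists y z', (forall k, In (y k) (T k)) /\ code y z' /\
       U i z' /\ x n <> y n)) as [Hn|Hn].
    - destruct (least_witness _ Hn) as [n [[y [z' [Hy [Hz' [Uz' Hxy]]]]] Hmin]].
      assert (Hag : forall y z, (forall k, In (y k) (T k)) -> code y z -> U i z -> agree n x y).
      { intros y1 z1 A1 A2 A3 k Hk. apply NNPP. intros Hne.
        apply (Hmin k Hk). exists y1, z1. auto. }
      exists (x, n). intros _. simpl. split; [|exact Hag].
      assert (weight w x n <= K * Rpower (r i) s); [|nra].
      apply (Hsep x y n z z' (r i)); eauto.
      + apply Hr.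
      + apply (proj2 (Hr i)); auto.
    - destruct (pow_lt_1_zero (/ 2)) with (y := Rpower (r i) s) as [n Hn2]; auto.
      { rewrite Rabs_pos_eq; lra. }
      exists (x, n). intros _. simpl. split.
      + specialize (Hn2 n (Nat.le_refl n)). rewrite Rabs_pos_eq in Hn2
          by (apply pow_le; lra).
        pose proof (weight_le_half_pow w x n Hw (fun k => Hhalf k _ (Hx k))). nra.
      + intros y z' A1 A2 A3 k Hk. apply NNPP. intros Hne. apply Hn.
        exists k, y, z'. auto. }
  destruct (avoiding_word T w act (fun i => fst (f i)) (fun i => snd (f i)) (/ 2))
    as [x [Hx Havoid]]; auto; try lra.
  - intros N.
    apply Rle_trans with ((K + 1) * sum_f_R0 (fun i =>
      if excluded_middle_informative (exists z, U i z) then Rpower (r i) s else 0) N).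
    + rewrite scal_sum. apply sum_f_R0_mono. intros i.
      fold (charge (exists z, U i z) (Rpower (r i) s)).
      assert (HR : 0 < Rpower (r i) s) by apply exp_pos.
      apply Rle_trans with (charge (exists z, U i z) (Rpower (r i) s * (K + 1))).
      * apply charge_mono.
        -- apply Rlt_le, weight_pos; auto.
        -- nra.
        -- intros Hact. destruct (Hf i Hact) as [H1 _]. split; [|lra].
           destruct Hact as [y [z [_ [_ Hz]]]]. exists z; auto.
      * unfold charge. destruct excluded_middle_informative; lra.
    + assert (HS : Rbar_le (sum_f_R0 (fun i =>
        if excluded_middle_informative (exists z, U i z) then Rpower (r i) s else 0) N)
        (cover_cost U r s)).
      { unfold cover_cost. apply (proj1 (Lub_Rbar_correct _)). exists N. reflexivity. }
      pose proof (Rbar_le_lt_trans _ _ _ HS Hcost) as HS2. simpl in HS2.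
      apply (Rmult_lt_compat_l (K + 1)) in HS2; [|lra].
      assert ((K + 1) * eta = / 2) by (unfold eta; field; lra). lra.
  - destruct (Hex x Hx) as [z [Ez Hz]]. destruct (Hcover z Ez) as [i Ui].
    assert (Hact : act i) by (exists x, z; auto).
    apply (Havoid i Hact). exact (proj2 (Hf i Hact) x z Hx Hz Ui).
Qed.


(** * Local behaviour near a pole *)

(** The two-sided estimates of (KU4) with denominators cleared and [alpha] in place of
    [|a|^(-beta)]; the lower bound for the derivative drops the factor [m >= 1]. The limit [L] is
    kept because bounds on moduli say nothing about the argument of [f] near [a]. *)
Record polar (f : C -> C) (a : C) (m : nat) (K alpha r : R) : Prop := {
  polar_m : (1 <= m)%nat;
  polar_K : 1 <= K;
  polar_alpha : 0 < alpha;
  polar_lim : exists L : C, L <> RtoC 0 /\ forall eps, 0 < eps ->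
    exists del, 0 < del /\ forall z, 0 < Cmod (z - a) < del ->
      Cmod ((z - a) ^ m * f z - L) < eps;
  polar_low : forall z, 0 < Cmod (z - a) < r -> alpha <= K * (Cmod (f z) * Cmod (z - a) ^ m);
  polar_up : forall z, 0 < Cmod (z - a) < r -> Cmod (f z) * Cmod (z - a) ^ m <= K * alpha;
  polar_diff : forall z, 0 < Cmod (z - a) < r -> exists d, differentiable_at f z d /\
    alpha <= K * (Cmod d * Cmod (z - a) ^ S m) /\
    Cmod d * Cmod (z - a) ^ S m <= K * INR m * alpha }.

Lemma differentiable_ext_loc (g h : C -> C) (z d : C) (e : R) :
  0 < e -> (forall y, Cmod (y - z) < e -> g y = h y) ->
  differentiable_at g z d -> differentiable_at h z d.
Proof.
  intros He Heq Hd eps Heps. destruct (Hd eps Heps) as [del [Hdel H]].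
  exists (Rmin del e). split; [apply Rmin_pos; auto|]. intros y Hy.
  rewrite <- (Heq y) by (eapply Rlt_le_trans; [exact Hy|apply Rmin_r]).
  rewrite <- (Heq z) by (rewrite Cmod_sub_self; auto).
  apply H. eapply Rlt_le_trans; [exact Hy|apply Rmin_l].
Qed.

Lemma pow_le_self (t : R) (m : nat) : (1 <= m)%nat -> 0 <= t <= 1 -> t ^ m <= t.
Proof.
  intros Hm Ht. destruct m as [|m]; [lia|]. simpl.
  assert (t ^ m <= 1) by (rewrite <- (pow1 m); apply pow_incr; auto). nra.
Qed.

Lemma pow_le_reg (x y : R) (m : nat) : (1 <= m)%nat -> 0 <= x -> 0 <= y -> x ^ m <= y ^ m -> x <= y.
Proof.
  intros Hm Hx Hy H. apply Rnot_lt_le. intros Hlt.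
  assert (y ^ m < x ^ m); [|lra].
  clear H. destruct m as [|m]; [lia|]. clear Hm.
  induction m as [|m IH]; [simpl; lra|].
  change (y * y ^ S m < x * x ^ S m).
  pose proof (pow_le y (S m) Hy). nra.
Qed.

Section Polar.
Context (f : C -> C) (a : C) (m : nat) (K alpha r : R).
Context (Hp : polar f a m K alpha r).

Lemma polar_neq_0 z : 0 < Cmod (z - a) < r -> f z <> RtoC 0.
Proof.
  intros Hz E. pose proof (polar_low _ _ _ _ _ _ Hp z Hz) as H.
  pose proof (polar_alpha _ _ _ _ _ _ Hp).
  rewrite E, Cmod_0 in H. lra.
Qed.

(** Near the pole [f] behaves like [L / (z - a)^m]. On a ray where [(z - a)^m] is a positive
    multiple of [L / v], the value [1/f] points almost towards [1/v], hence is closer to it than [0]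
    is. So the pole cannot minimise [|1/f - 1/v|]. *)
Lemma polar_direction (v : C) (del : R) : v <> RtoC 0 -> 0 < del -> del < r ->
  exists z, 0 < Cmod (z - a) <= del /\ Cmod (/ f z - / v) < Cmod (/ v).
Proof.
  intros Hv Hdel Hdr.
  destruct (polar_lim _ _ _ _ _ _ Hp) as [L [HL Hlim]].
  assert (HvP : 0 < Cmod v) by (apply Cmod_gt_0; auto).
  assert (HLP : 0 < Cmod L) by (apply Cmod_gt_0; auto).
  (* An error [e] below [|L|/4] gives [|e / (L + e)| <= 1/3], and then [(1 - tau) + tau/3 < 1]. *)
  destruct (Hlim (Cmod L / 4) ltac:(lra)) as [dl [Hdl H]].
  assert (Hq : (L / v)%C <> RtoC 0).
  { apply Cmod_gt_0. rewrite Cmod_div by auto. apply Rdiv_lt_0_compat; auto. }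
  assert (HqP : 0 < Cmod (L / v)) by (apply Cmod_gt_0; auto).
  destruct (complex_root ((L / v) / RtoC (Cmod (L / v)))%C m (polar_m _ _ _ _ _ _ Hp))
    as [zeta [Hz1 Hzm]].
  { rewrite Cmod_div, Cmod_R, Rabs_pos_eq by
      (try lra; apply Cmod_gt_0; rewrite Cmod_R, Rabs_pos_eq; lra). field. lra. }
  (* The bounds [1] and [|L|/|v|] ensure [t^m |v|/|L| <= 1], so that the target [1/v] is not
     overshot. *)
  set (t := Rmin (Rmin (dl / 2) del) (Rmin 1 (Cmod L / Cmod v))).
  assert (HLv : 0 < Cmod L / Cmod v) by (apply Rdiv_lt_0_compat; auto).
  assert (Ht : 0 < t) by (repeat apply Rmin_pos; lra).
  assert (Hts : t <= dl / 2 /\ t <= del /\ t <= 1 /\ t <= Cmod L / Cmod v).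
  { pose proof (Rmin_l (Rmin (dl / 2) del) (Rmin 1 (Cmod L / Cmod v))).
    pose proof (Rmin_r (Rmin (dl / 2) del) (Rmin 1 (Cmod L / Cmod v))).
    pose proof (Rmin_l (dl / 2) del). pose proof (Rmin_r (dl / 2) del).
    pose proof (Rmin_l 1 (Cmod L / Cmod v)). pose proof (Rmin_r 1 (Cmod L / Cmod v)).
    fold t in H0, H1. lra. }
  set (z := (a + RtoC t * zeta)%C).
  assert (Hza : (z - a = RtoC t * zeta)%C) by (unfold z; ring).
  assert (HzP : Cmod (z - a) = t) by (rewrite Hza, Cmod_RtoC_mult, Hz1; lra).
  exists z. split; [lra|].
  specialize (H z ltac:(lra)).
  set (tau := t ^ m * (Cmod v / Cmod L)).
  assert (Htm : 0 < t ^ m) by (apply pow_lt; auto).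
  assert (Htau : 0 < tau <= 1).
  { split; [apply Rmult_lt_0_compat; auto; apply Rdiv_lt_0_compat; auto|].
    assert (t ^ m <= t) by (apply pow_le_self; [apply (polar_m _ _ _ _ _ _ Hp)|lra]).
    unfold tau. apply Rle_trans with (Cmod L / Cmod v * (Cmod v / Cmod L)).
    - apply Rmult_le_compat_r; [|lra]. apply Rlt_le, Rdiv_lt_0_compat; auto.
    - apply Req_le. field. lra. }
  assert (HP : ((z - a) ^ m = RtoC tau * (L / v))%C).
  { rewrite Hza, Cpow_mult_l, Hzm, <- RtoC_pow. unfold tau.
    rewrite RtoC_mult, RtoC_div by lra. rewrite Cmod_div, RtoC_div by (auto; lra).
    field. repeat split; auto; intros E; apply RtoC_inj in E; lra. }
  set (e := ((z - a) ^ m * f z - L)%C) in *.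
  assert (Hle : 3 * Cmod L / 4 <= Cmod (L + e)).
  { pose proof (Cmod_le_sub L (- e)). rewrite Cmod_opp in H0.
    replace (L - - e)%C with (L + e)%C in H0 by ring. lra. }
  assert (Hle0 : (L + e)%C <> RtoC 0) by (apply Cmod_gt_0; lra).
  assert (Hf0 : f z <> RtoC 0) by (apply polar_neq_0; lra).
  assert (Hfz : (/ f z - / v = / v * (RtoC (tau - 1) - RtoC tau * (e / (L + e))))%C).
  { assert (Hfe : (f z * (RtoC tau * (L / v)) = L + e)%C).
    { rewrite <- HP. unfold e. ring. }
    assert (Htau0 : RtoC tau <> RtoC 0) by (intros E; apply RtoC_inj in E; lra).
    replace (f z) with ((L + e) / (RtoC tau * (L / v)))%C.
    - rewrite RtoC_minus. field. auto.
    - rewrite <- Hfe. field. auto. }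
  rewrite Hfz, Cmod_mult.
  assert (Hv' : 0 < Cmod (/ v)) by (rewrite Cmod_inv by auto; apply Rinv_0_lt_compat; auto).
  assert (Hfrac : Cmod (e / (L + e)) <= 1 / 3).
  { rewrite Cmod_div by auto. apply Rle_div_l; lra. }
  assert (Cmod (RtoC (tau - 1) - RtoC tau * (e / (L + e))) < 1).
  { eapply Rle_lt_trans; [apply Cmod_sub_le|].
    rewrite Cmod_R, Cmod_RtoC_mult, Rabs_left1 by lra. nra. }
  nra.
Qed.

(* Minimise [|1/f - 1/v|] over the disc, [1/f] being extended by [0] at the pole. *)
Lemma polar_surjective (v : C) (del : R) : 0 < del -> del < r ->
  3 * K * alpha <= Cmod v * del ^ m ->
  exists z, 0 < Cmod (z - a) <= del /\ f z = v.
Proof.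
  intros Hdel Hdr Hv.
  pose proof (polar_K _ _ _ _ _ _ Hp) as HK.
  pose proof (polar_alpha _ _ _ _ _ _ Hp) as Hal.
  pose proof (polar_m _ _ _ _ _ _ Hp) as Hm.
  assert (Hdm : 0 < del ^ m) by (apply pow_lt; auto).
  assert (HKa : 0 < K * alpha) by nra.
  assert (HvP : 0 < Cmod v).
  { apply Rnot_le_lt. intros Hle. pose proof (Cmod_ge_0 v). nra. }
  assert (Hv0 : v <> RtoC 0) by (apply Cmod_gt_0; auto).
  set (h := fun z => if excluded_middle_informative (z = a) then RtoC 0 else (/ f z)%C).
  assert (Ha : h a = RtoC 0).
  { unfold h. destruct excluded_middle_informative; tauto. }
  assert (Hna : forall z, z <> a -> h z = (/ f z)%C).
  { intros z Hz. unfold h. destruct excluded_middle_informative; tauto. }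
  assert (Hdiff : forall x, 0 < Cmod (x - a) <= del ->
    exists d, differentiable_at h x d /\ 0 < Cmod d).
  { intros x Hx.
    destruct (polar_diff _ _ _ _ _ _ Hp x ltac:(lra)) as [d [Hd [Hlow _]]].
    assert (Hfx : f x <> RtoC 0) by (apply polar_neq_0; lra).
    exists (- (d / (f x * f x)))%C. split.
    - apply (differentiable_ext_loc (fun x => / f x)%C h x _ (Cmod (x - a))); [lra| |].
      + intros y Hy. symmetry. apply Hna. intros ->.
        rewrite Cmod_sub_sym in Hy. lra.
      + apply differentiable_inv; auto.
    - rewrite Cmod_opp, Cmod_div by (apply Cmult_neq_0; auto).
      apply Rdiv_lt_0_compat.
      + pose proof (Cmod_ge_0 d). apply Rnot_le_lt. intros Hle.
        assert (E : Cmod d = 0) by lra. rewrite E in Hlow. lra.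
      + rewrite Cmod_mult. pose proof (proj1 (Cmod_gt_0 _) Hfx). nra. }
  set (u := (/ v)%C).
  assert (Hu : 0 < Cmod u) by (unfold u; rewrite Cmod_inv by auto; apply Rinv_0_lt_compat; auto).
  assert (Hau : Cmod (h a - u) = Cmod u).
  { rewrite Ha. replace (0 - u)%C with (- u)%C by ring. apply Cmod_opp. }
  destruct (disc_minimum (fun z => Cmod (h z - u)) a del) as [x [Hx Hmin]].
  - lra.
  - intros x; apply Cmod_ge_0.
  - intros x Hx eps He.
    assert (Hc : exists dd, 0 < dd /\ forall y, Cmod (y - a) <= del -> Cmod (y - x) < dd ->
       Cmod (h y - h x) < eps).
    { destruct (excluded_middle_informative (x = a)) as [->|Hxa].
      (* At the pole continuity comes from [|1/f y| <= (K/alpha) |y - a|^m], where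
         [|y - a|^m <= |y - a|] within distance [1]. *)
      - exists (Rmin 1 (alpha * eps / K)). split.
        { apply Rmin_pos; [lra|]. apply Rdiv_lt_0_compat; [|lra]. nra. }
        intros y Hy1 Hy2. rewrite Ha.
        destruct (excluded_middle_informative (y = a)) as [->|Hya].
        { rewrite Ha, Cmod_sub_self. auto. }
        assert (Hya' : 0 < Cmod (y - a) < r) by (split; [apply Cmod_sub_pos; auto|lra]).
        rewrite Hna by auto. replace (/ f y - 0)%C with (/ f y)%C by ring.
        pose proof (polar_neq_0 y Hya') as Hfy.
        rewrite Cmod_inv by auto.
        pose proof (polar_low _ _ _ _ _ _ Hp y Hya') as Hlow.
        pose proof (Rlt_le_trans _ _ _ Hy2 (Rmin_l _ _)) as B1.
        pose proof (Rlt_le_trans _ _ _ Hy2 (Rmin_r _ _)) as B2.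
        apply Rlt_div_r in B2; [|lra].
        assert (B3 : Cmod (y - a) ^ m <= Cmod (y - a)) by (apply pow_le_self; auto; lra).
        pose proof (proj1 (Cmod_gt_0 _) Hfy) as Hfy'.
        apply Rmult_lt_reg_l with (Cmod (f y)); [auto|].
        rewrite Rinv_r by lra.
        apply Rmult_lt_reg_l with alpha; [auto|].
        assert (Cmod (f y) * Cmod (y - a) ^ m <= Cmod (f y) * Cmod (y - a)) by nra.
        nra.
      - assert (Hx' : 0 < Cmod (x - a) <= del) by (split; [apply Cmod_sub_pos|]; auto).
        destruct (Hdiff x Hx') as [d [Hd _]].
        destruct (differentiable_cont _ _ _ Hd eps He) as [dd [Hdd H]].
        exists dd. split; auto. }
    destruct Hc as [dd [Hdd Hc]]. exists dd. split; [auto|]. intros y Hy1 Hy2.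
    specialize (Hc y Hy1 Hy2).
    pose proof (Cmod_sub_triangle (h x) (h y) u) as T1.
    rewrite (Cmod_sub_sym (h x) (h y)) in T1. lra.
  - assert (Hxa : x <> a).
    { intros ->. destruct (polar_direction v del Hv0 Hdel Hdr) as [z [Hz1 Hz2]].
      specialize (Hmin z ltac:(lra)).
      rewrite (Hna z) in Hmin by (apply Cmod_sub_pos_neq; lra).
      fold u in Hz2. lra. }
    pose proof (Cmod_sub_pos _ _ Hxa) as Hxp.
    (* On the boundary circle [|f| <= |v|/3], so [|1/f - u| >= 2 |u|], while the pole already
       achieves [|u|]. *)
    assert (Hxd : Cmod (x - a) < del).
    { apply Rnot_le_lt. intros Hge. assert (E : Cmod (x - a) = del) by lra.
      pose proof (polar_up _ _ _ _ _ _ Hp x ltac:(lra)) as Hup. rewrite E in Hup.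
      specialize (Hmin a ltac:(rewrite Cmod_sub_self; lra)). rewrite Hau in Hmin.
      assert (Hfx : f x <> RtoC 0) by (apply polar_neq_0; lra).
      pose proof (proj1 (Cmod_gt_0 _) Hfx) as HfP.
      rewrite Hna in Hmin by auto.
      assert (H3 : 3 * Cmod (f x) <= Cmod v).
      { apply Rmult_le_reg_r with (del ^ m); auto. lra. }
      assert (Hinv : 3 * Cmod u <= Cmod (/ f x)).
      { unfold u. rewrite !Cmod_inv by auto.
        apply Rmult_le_reg_r with (Cmod (f x)); auto.
        rewrite Rinv_l by lra. apply Rmult_le_reg_r with (Cmod v); auto.
        replace (3 * / Cmod v * Cmod (f x) * Cmod v) with (3 * Cmod (f x)) by (field; lra).
        lra. }
      pose proof (Cmod_le_sub (/ f x) u). lra. }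
    exists x. split; [lra|].
    (* The minimiser is now interior and different from the pole, where the derivative of [1/f] is
       nonzero; descent without penalty applies. *)
    assert (Hhx : h x = u).
    { apply NNPP. intros Hne.
      destruct (Hdiff x ltac:(lra)) as [d [Hd HdP]].
      destruct (descent h x d u 0 (del - Cmod (x - a)) Hd Hne ltac:(lra) ltac:(lra))
        as [y [Hy1 Hy2]].
      pose proof (Cmod_sub_triangle y x a).
      specialize (Hmin y ltac:(lra)). lra. }
    rewrite Hna in Hhx by auto. unfold u in Hhx.
    assert (Hfx : f x <> RtoC 0) by (apply polar_neq_0; lra).
    replace (f x) with (/ / f x)%C by (field; auto). rewrite Hhx. field. auto.
Qed.

(** On the disc of radius [|z - a|/2] about [z], the distance to the pole is below [2 |z - a|], so
    the two-sided bounds give [|f'| > |f z| / (Q |z - a|)] with [Q = K^2 2^(m+1)]. This is the slope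
    [lam] passed to [lift_value]. *)
Lemma polar_lift (z v : C) : 0 < Cmod (z - a) -> 3 / 2 * Cmod (z - a) < r ->
  2 * (K ^ 2 * 2 ^ S m) * Cmod (f z - v) < Cmod (f z) ->
  exists x, Cmod (x - z) <= Cmod (z - a) / 2 /\ f x = v /\
    Cmod (f z) * Cmod (x - z) <= (K ^ 2 * 2 ^ S m) * Cmod (z - a) * Cmod (f z - v).
Proof.
  intros Hz Hzr Hv.
  pose proof (polar_K _ _ _ _ _ _ Hp) as HK.
  pose proof (polar_alpha _ _ _ _ _ _ Hp) as Hal.
  set (Q := K ^ 2 * 2 ^ S m) in *. set (s := Cmod (z - a)) in *.
  assert (H2 : 0 < 2 ^ S m) by (apply pow_lt; lra).
  assert (HQ : 0 < Q) by (apply Rmult_lt_0_compat; auto; apply pow_lt; lra).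
  assert (HfP : 0 < Cmod (f z)).
  { pose proof (Cmod_ge_0 (f z - v)). nra. }
  assert (HQs : 0 < Q * s) by (apply Rmult_lt_0_compat; auto).
  set (lam := Cmod (f z) / (Q * s)).
  assert (Hlam : 0 < lam) by (apply Rdiv_lt_0_compat; auto).
  assert (Hlq : lam * (Q * s) = Cmod (f z)) by (unfold lam; field; lra).
  destruct (lift_value f z v (s / 2) lam) as [x [Hx1 [Hx2 Hx3]]]; auto; try lra.
  - intros x Hx.
    assert (Hxa : 0 < Cmod (x - a) < r /\ Cmod (x - a) < 2 * s).
    { pose proof (Cmod_sub_triangle x z a). pose proof (Cmod_sub_triangle z x a).
      rewrite (Cmod_sub_sym z x) in H0. fold s in H, H0. lra. }
    destruct Hxa as [Hxa Hxs].
    destruct (polar_diff _ _ _ _ _ _ Hp x Hxa) as [d [Hd [Hlow _]]].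
    exists d. split; [auto|].
    pose proof (polar_up _ _ _ _ _ _ Hp z ltac:(fold s; lra)) as Hup. fold s in Hup.
    assert (Hs : 0 < s ^ S m) by (apply pow_lt; auto).
    assert (Hpow : Cmod (x - a) ^ S m < 2 ^ S m * s ^ S m).
    { rewrite <- Rpow_mult_distr. apply Rnot_le_lt. intros Hle.
      apply pow_le_reg in Hle; try lia; lra. }
    assert (HdP : 0 < Cmod d).
    { pose proof (Cmod_ge_0 d). apply Rnot_le_lt. intros Hle.
      assert (E : Cmod d = 0) by lra. rewrite E in Hlow. lra. }
    assert (H1 : Cmod d * Cmod (x - a) ^ S m < Cmod d * (2 ^ S m * s ^ S m))
      by (apply Rmult_lt_compat_l; auto).
    assert (H3 : alpha < K * (Cmod d * (2 ^ S m * s ^ S m))) by nra.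
    assert (H4 : Cmod (f z) * s ^ m < K * (K * (Cmod d * (2 ^ S m * s ^ S m)))) by nra.
    assert (Hsm : 0 < s ^ m) by (apply pow_lt; auto).
    apply Rmult_lt_reg_r with (Q * s); [auto|]. rewrite Hlq.
    apply Rmult_lt_reg_r with (s ^ m); [auto|].
    eapply Rlt_le_trans; [exact H4|]. apply Req_le. unfold Q. simpl. ring.
  - assert (lam * (s / 2) * (2 * Q) = Cmod (f z)) by (rewrite <- Hlq; field).
    apply Rmult_lt_reg_r with (2 * Q); lra.
  - exists x. repeat split; auto.
    rewrite <- Hlq.
    apply Rmult_le_compat_l with (r := Q * s) in Hx3; lra.
Qed.

(** The condition [|f| <= B] forces distance at least [rho] from the pole. If [|y - x| < rho/2], the
    segment stays at distance at least [rho/2], and the upper derivative bound there gives the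
    estimate. Otherwise [|f y - f x| <= 2 B] suffices, since the constant is at least [4]. *)
Lemma polar_lipschitz (x y : C) (B rho : R) :
  0 < Cmod (x - a) < r -> 0 < Cmod (y - a) < r ->
  Cmod (f x) <= B -> Cmod (f y) <= B -> 0 < rho -> K * B * rho ^ m = alpha ->
  rho * Cmod (f y - f x) <= K ^ 2 * INR m * 2 ^ S m * B * Cmod (y - x).
Proof.
  intros Hx Hy Bx By Hrho Heq.
  pose proof (polar_K _ _ _ _ _ _ Hp) as HK.
  pose proof (polar_alpha _ _ _ _ _ _ Hp) as Hal.
  pose proof (polar_m _ _ _ _ _ _ Hp) as Hm.
  assert (HB : 0 <= B) by (pose proof (Cmod_ge_0 (f x)); lra).
  assert (Hm1 : 1 <= INR m) by (apply (le_INR 1); auto).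
  assert (H2 : 4 <= 2 ^ S m).
  { replace 4 with (2 ^ 2) by ring. apply Rle_pow; [lra|lia]. }
  assert (HK2 : 1 <= K ^ 2) by nra.
  assert (HC : 4 <= K ^ 2 * INR m * 2 ^ S m).
  { assert (1 <= K ^ 2 * INR m) by nra. nra. }
  assert (Hfar : forall z, 0 < Cmod (z - a) < r -> Cmod (f z) <= B -> rho <= Cmod (z - a)).
  { intros z Hz Bz. pose proof (polar_low _ _ _ _ _ _ Hp z Hz) as Hlow.
    pose proof (pow_lt _ m (proj1 Hz)) as Hpz.
    apply (pow_le_reg _ _ m); auto; try lra.
    assert (0 < B) by (apply Rnot_le_lt; intros ?; assert (E : B = 0) by lra; rewrite E in Heq; lra).
    assert (Cmod (f z) * Cmod (z - a) ^ m <= B * Cmod (z - a) ^ m) by nra.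
    apply Rmult_le_reg_l with (K * B); [nra|]. nra. }
  pose proof (Hfar x Hx Bx) as Fx. pose proof (Hfar y Hy By) as Fy.
  pose proof (Cmod_ge_0 (y - x)) as Hyx.
  destruct (Rlt_le_dec (Cmod (y - x)) (rho / 2)) as [Hc|Hc].
  - assert (HM : Cmod (f y - f x) <= K ^ 2 * INR m * 2 ^ S m * B / rho * Cmod (y - x)).
    { apply Cmod_MVT. intros t Ht.
      set (p := (x + RtoC t * (y - x))%C).
      assert (Hpx : Cmod (p - x) <= Cmod (y - x)).
      { replace (p - x)%C with (RtoC t * (y - x))%C by (unfold p; ring).
        rewrite Cmod_RtoC_mult by lra. nra. }
      assert (Hpa : Cmod (p - a) < r).
      { replace (p - a)%C with (RtoC (1 - t) * (x - a) + RtoC t * (y - a))%C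
          by (unfold p; rewrite RtoC_minus; ring).
        eapply Rle_lt_trans; [apply Cmod_triangle|].
        rewrite !Cmod_RtoC_mult by lra.
        destruct (Req_dec t 0) as [->|Ht0]; [lra|]. nra. }
      assert (Hpl : rho / 2 <= Cmod (p - a)).
      { pose proof (Cmod_sub_triangle x p a). rewrite (Cmod_sub_sym x p) in H. lra. }
      destruct (polar_diff _ _ _ _ _ _ Hp p ltac:(lra)) as [d [Hd [_ Hup]]].
      exists d. split; [exact Hd|].
      assert (Hpw : (rho / 2) ^ S m <= Cmod (p - a) ^ S m) by (apply pow_incr; lra).
      pose proof (Cmod_ge_0 d) as Hd0.
      assert (H1 : Cmod d * (rho / 2) ^ S m <= K * INR m * alpha) by nra.
      assert (Hrm : 0 < (rho / 2) ^ S m) by (apply pow_lt; lra).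
      apply Rmult_le_reg_r with ((rho / 2) ^ S m); [auto|].
      eapply Rle_trans; [exact H1|]. apply Req_le. rewrite <- Heq.
      unfold Rdiv at 2. rewrite Rpow_mult_distr, pow_inv.
      change (rho ^ S m) with (rho * rho ^ m).
      field. split; [|lra]. apply pow_nonzero; lra. }
    apply Rmult_le_compat_l with (r := rho) in HM; [|lra].
    eapply Rle_trans; [exact HM|]. apply Req_le. field. lra.
  - assert (Hd : Cmod (f y - f x) <= 2 * B).
    { eapply Rle_trans; [apply Cmod_sub_le|]. lra. }
    assert (H1 : rho * Cmod (f y - f x) <= rho * (2 * B)) by (apply Rmult_le_compat_l; lra).
    assert (H3 : 4 * (B * Cmod (y - x)) <= K ^ 2 * INR m * 2 ^ S m * (B * Cmod (y - x))).
    { apply Rmult_le_compat_r; auto. apply Rmult_le_pos; auto. }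
    assert (B * (rho / 2) <= B * Cmod (y - x)) by (apply Rmult_le_compat_l; auto).
    lra.
Qed.

End Polar.


(** * Orbits following a sequence of poles *)

Lemma fin_Some (f : C -> Chat) (z v : C) : f z = Some v -> fin f z = v.
Proof. intros H. unfold fin. rewrite H. reflexivity. Qed.

Lemma not_None_fin (f : C -> Chat) (z : C) : f z <> None -> f z = Some (fin f z).
Proof. intros H. unfold fin. destruct (f z); [reflexivity|tauto]. Qed.

Lemma Fit_S (f0 : C -> Chat) (c : nat -> C) (n : nat) (z w : C) :
  Fit f0 c n z = Some w -> f0 w <> None ->
  Fit f0 c (S n) z = Some (fin f0 w + c (S n))%C.
Proof. intros H Hw. simpl. rewrite H, (not_None_fin f0 w Hw). reflexivity. Qed.

Lemma Fit_S_inv (f0 : C -> Chat) (c : nat -> C) (n : nat) (z v : C) :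
  Fit f0 c (S n) z = Some v ->
  exists w, Fit f0 c n z = Some w /\ f0 w <> None /\ v = (fin f0 w + c (S n))%C.
Proof.
  simpl. destruct (Fit f0 c n z) as [w|]; [|discriminate].
  destruct (f0 w) as [u|] eqn:E; [|discriminate].
  intros H. injection H as <-. exists w. rewrite (fin_Some _ _ _ E).
  repeat split; congruence.
Qed.

Definition lift_const (K : R) (m : nat) : R := K ^ 2 * 2 ^ S m.

(** The constant of [polar_lipschitz] for values up to [2 B], where
    [1/rho = (2 K B |a|^beta)^(1/m)]. *)
Definition lip_const (K : R) (m : nat) : R :=
  2 * (K ^ 2 * INR m * 2 ^ S m) * Rpower (2 * K) (/ INR m).

(** The last two thresholds concern [a] as the next pole to be reached: a value near it has modulus
    at least [|a|/2], which is large enough for [polar_surjective] in the first case and for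
    [polar_lift] up to distance [1] in the second. *)
Record ku_pole (f0 : C -> Chat) (m : nat) (K beta r del : R) (a : C) : Prop := {
  ku_None : f0 a = None;
  ku_polar : polar (fin f0) a m K (Rpower (Cmod a) (- beta)) r;
  ku_def : forall z, 0 < Cmod (z - a) < r -> f0 z <> None;
  ku_ge4 : 4 <= Cmod a;
  ku_surj : 6 * K <= Cmod a * del ^ m;
  ku_lift : 4 * lift_const K m < Cmod a }.

Definition follows (f0 : C -> Chat) (c : nat -> C) (del : R) (n : nat) (w : nat -> C) (z : C) :=
  forall k, (k <= n)%nat -> exists v, Fit f0 c k z = Some v /\ Cmod (v - w k) <= del.

Definition code (f0 : C -> Chat) (c : nat -> C) (del : R) (w : nat -> C) (z : C) :=
  forall n, follows f0 c del n w z.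

Section Orbits.
Context (f0 : C -> Chat) (c : nat -> C) (m : nat) (K beta r del : R).
Context (Hdel : 0 < del) (Hdel1 : del <= 1) (Hr : 4 * del <= r) (Hbeta : 0 <= beta).
Context (Hc : forall n, Cmod (c n) < del).

Notation pole := (ku_pole f0 m K beta r del).

Lemma ku_alpha_le_1 a : pole a -> Rpower (Cmod a) (- beta) <= 1.
Proof.
  intros Ha. pose proof (ku_ge4 _ _ _ _ _ _ _ Ha).
  rewrite Rpower_Ropp, <- Rinv_1. apply Rinv_le_contravar; [lra|].
  rewrite <- (Rpower_O (Cmod a)) by lra. apply Rle_Rpower; lra.
Qed.

Lemma orbit_value_bounds a y n : pole a -> Cmod (y - a) <= del ->
  Cmod a / 2 <= Cmod (y - c n) <= 2 * Cmod a.
Proof.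
  intros Ha Hy. pose proof (ku_ge4 _ _ _ _ _ _ _ Ha) as H4. specialize (Hc n).
  pose proof (Cmod_sub_le y (c n)) as H1.
  pose proof (Cmod_le_sub y a) as H2.
  pose proof (Cmod_le_sub a y) as H3. rewrite Cmod_sub_sym in H3.
  pose proof (Cmod_le_sub y (c n)) as H5. lra.
Qed.

(** The end point of the orbit is prescribed, and the orbit is built backwards: [polar_surjective]
    supplies a preimage near the preceding pole. *)
Lemma follows_exists w n y : (forall k, pole (w k)) -> Cmod (y - w n) <= del ->
  exists z, Fit f0 c n z = Some y /\ follows f0 c del n w z.
Proof.
  intros Hw. revert y. induction n as [|n IH]; intros y Hy.
  - exists y. split; [reflexivity|]. intros k Hk. replace k with O by lia.
    exists y. split; [reflexivity|auto].
  - pose proof (orbit_value_bounds _ _ (S n) (Hw (S n)) Hy) as [Hb _].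
    pose proof (ku_surj _ _ _ _ _ _ _ (Hw (S n))) as Hs.
    pose proof (polar_K _ _ _ _ _ _ (ku_polar _ _ _ _ _ _ _ (Hw n))) as HK.
    pose proof (ku_alpha_le_1 _ (Hw n)) as Hal.
    destruct (polar_surjective _ _ _ _ _ _ (ku_polar _ _ _ _ _ _ _ (Hw n))
      (y - c (S n))%C del) as [x [Hx1 Hx2]]; auto; try lra.
    { assert (0 < del ^ m) by (apply pow_lt; auto). nra. }
    destruct (IH x) as [z [Hz1 Hz2]]; [lra|].
    assert (HzS : Fit f0 c (S n) z = Some y).
    { rewrite (Fit_S f0 c n z x Hz1).
      - f_equal. rewrite Hx2. ring.
      - apply (ku_def _ _ _ _ _ _ _ (Hw n)). lra. }
    exists z. split; [auto|]. intros k Hk.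
    destruct (Nat.eq_dec k (S n)) as [->|Hne].
    + exists y. auto.
    + apply Hz2. lia.
Qed.

Lemma follows_step w n z v : (forall k, pole (w k)) -> follows f0 c del (S n) w z ->
  Fit f0 c n z = Some v ->
  0 < Cmod (v - w n) <= del /\ Cmod (v - w n) < r /\
  Cmod (w (S n)) / 2 <= Cmod (fin f0 v) <= 2 * Cmod (w (S n)).
Proof.
  intros Hw Hf Hv.
  destruct (Hf n ltac:(lia)) as [v1 [E1 H1]]. rewrite Hv in E1. injection E1 as <-.
  destruct (Hf (S n) (Nat.le_refl _)) as [v' [E' H']].
  destruct (Fit_S_inv _ _ _ _ _ E') as [u [Eu [Hu ->]]].
  rewrite Hv in Eu. injection Eu as <-.
  pose proof (orbit_value_bounds _ _ (S n) (Hw (S n)) H') as Hb.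
  replace (fin f0 v + c (S n) - c (S n))%C with (fin f0 v) in Hb by ring.
  assert (v <> w n).
  { intros ->. apply Hu, (ku_None _ _ _ _ _ _ _ (Hw n)). }
  pose proof (Cmod_sub_pos _ _ H). repeat split; lra.
Qed.

(** A cluster point of points following longer and longer initial words follows the whole word. The
    induction carries continuity of the iterates at [z], so that the closed conditions pass to the
    limit; the risk is that the limit orbit hits a pole. *)
Lemma code_exists w : (forall k, pole (w k)) -> exists z, code f0 c del w z.
Proof.
  intros Hw.
  destruct (choice_function nat C (fun n z => follows f0 c del n w z)) as [u Hu].
  { intros n. destruct (follows_exists w n (w n) Hw) as [z [_ Hz]].
    - rewrite Cmod_sub_self. lra.
    - exists z; auto. }
  destruct (bounded_cluster u (del + Cmod (w O))) as [z Hz].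
  { intros n. destruct (Hu n O ltac:(lia)) as [v [Ev Hv]]. simpl in Ev.
    injection Ev as <-. pose proof (Cmod_le_sub (u n) (w O)). lra. }
  exists z.
  assert (Hind : forall k, exists v, Fit f0 c k z = Some v /\ Cmod (v - w k) <= del /\
    forall eps, 0 < eps -> exists d, 0 < d /\ forall y, Cmod (y - z) < d ->
      exists v', Fit f0 c k y = Some v' /\ Cmod (v' - v) < eps).
  2:{ intros n k _. destruct (Hind k) as [v [E [H _]]]. exists v; auto. }
  (* The index [n] is at least [k + 1], so that the nearby orbit also visits the ball around the
     next pole. *)
  assert (Hclose : forall k v, Fit f0 c k z = Some v ->
    (forall eps, 0 < eps -> exists d, 0 < d /\ forall y, Cmod (y - z) < d ->
      exists v', Fit f0 c k y = Some v' /\ Cmod (v' - v) < eps) ->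
    forall eps, 0 < eps -> exists n v', (S k <= n)%nat /\
      Fit f0 c k (u n) = Some v' /\ Cmod (v' - v) < eps).
  { intros k v E H eps He. destruct (H eps He) as [d [Hd Hy]].
    destruct (Hz d Hd (S k)) as [n [Hn1 Hn2]].
    destruct (Hy (u n) Hn2) as [v' [E' H']]. exists n, v'. auto. }
  assert (Hdisc : forall k v, Fit f0 c k z = Some v ->
    (forall eps, 0 < eps -> exists d, 0 < d /\ forall y, Cmod (y - z) < d ->
      exists v', Fit f0 c k y = Some v' /\ Cmod (v' - v) < eps) ->
    Cmod (v - w k) <= del).
  { intros k v E H. apply Rnot_lt_le. intros Hlt.
    destruct (Hclose k v E H (Cmod (v - w k) - del) ltac:(lra)) as [n [v' [Hn [E' H']]]].
    destruct (Hu n k ltac:(lia)) as [v2 [E2 H2]]. rewrite E' in E2. injection E2 as <-.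
    pose proof (Cmod_sub_triangle v v' (w k)). rewrite (Cmod_sub_sym v v') in H0. lra. }
  induction k as [|k [v [Ev [Hv Hcont]]]].
  - assert (Hc0 : forall eps, 0 < eps -> exists d, 0 < d /\ forall y, Cmod (y - z) < d ->
      exists v', Fit f0 c 0 y = Some v' /\ Cmod (v' - z) < eps).
    { intros eps He. exists eps. split; auto. intros y Hy. exists y; auto. }
    exists z. split; [reflexivity|]. split; [apply (Hdisc O z); auto|auto].
  - pose proof (ku_polar _ _ _ _ _ _ _ (Hw k)) as Hp.
    pose proof (polar_K _ _ _ _ _ _ Hp) as HK.
    pose proof (polar_alpha _ _ _ _ _ _ Hp) as Hal.
    pose proof (ku_ge4 _ _ _ _ _ _ _ (Hw (S k))) as H4.
    set (al := Rpower (Cmod (w k)) (- beta)) in *.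
    assert (Hvk : v <> w k).
    { (* orbits through [w k] would leave the ball around [w (S k)] *)
      intros ->.
      set (B := 2 * Cmod (w (S k))).
      assert (HKB : 0 < K * B) by (unfold B; nra).
      destruct (Hclose k (w k) Ev Hcont (Rmin 1 (al / (K * B)))) as [n [v' [Hn [E' H']]]].
      { apply Rmin_pos; [lra|]. apply Rdiv_lt_0_compat; auto. }
      destruct (follows_step w k (u n) v' Hw) as [A1 [A2 [_ A3]]]; auto.
      { intros i Hi. apply (Hu n). lia. }
      pose proof (polar_low _ _ _ _ _ _ Hp v' ltac:(lra)) as Hlow.
      pose proof (Rlt_le_trans _ _ _ H' (Rmin_l _ _)) as B1.
      pose proof (Rlt_le_trans _ _ _ H' (Rmin_r _ _)) as B2.
      apply Rlt_div_r in B2; [|lra].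
      assert (Cmod (v' - w k) ^ m <= Cmod (v' - w k)).
      { apply pow_le_self; [apply (polar_m _ _ _ _ _ _ Hp)|lra]. }
      assert (0 <= Cmod (v' - w k) ^ m) by (apply pow_le; lra).
      fold B in A3.
      assert (Cmod (fin f0 v') * Cmod (v' - w k) ^ m <= B * Cmod (v' - w k)).
      { apply Rmult_le_compat; auto. apply Cmod_ge_0. }
      nra. }
    pose proof (Cmod_sub_pos _ _ Hvk) as Hvp.
    destruct (polar_diff _ _ _ _ _ _ Hp v ltac:(lra)) as [d [Hd _]].
    assert (Hfv : f0 v <> None) by (apply (ku_def _ _ _ _ _ _ _ (Hw k)); lra).
    exists (fin f0 v + c (S k))%C.
    assert (HS : Fit f0 c (S k) z = Some (fin f0 v + c (S k))%C) by (apply Fit_S; auto).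
    assert (HcS : forall eps, 0 < eps -> exists d, 0 < d /\ forall y, Cmod (y - z) < d ->
      exists v', Fit f0 c (S k) y = Some v' /\ Cmod (v' - (fin f0 v + c (S k))) < eps).
    { intros eps He.
      destruct (differentiable_cont _ _ _ Hd eps He) as [d1 [Hd1 H1]].
      destruct (Hcont (Rmin d1 (Cmod (v - w k)))) as [d2 [Hd2 H2]].
      { apply Rmin_pos; auto. }
      destruct (Hcont (r - Cmod (v - w k)) ltac:(lra)) as [d3 [Hd3 H3]].
      exists (Rmin d2 d3). split; [apply Rmin_pos; auto|]. intros y Hy.
      destruct (H2 y (Rlt_le_trans _ _ _ Hy (Rmin_l _ _))) as [v' [E' H']].
      destruct (H3 y (Rlt_le_trans _ _ _ Hy (Rmin_r _ _))) as [v2 [E2 H'']].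
      rewrite E' in E2. injection E2 as <-.
      pose proof (Rlt_le_trans _ _ _ H' (Rmin_l _ _)) as B1.
      pose proof (Rlt_le_trans _ _ _ H' (Rmin_r _ _)) as B2.
      exists (fin f0 v' + c (S k))%C. split.
      - apply Fit_S; auto. apply (ku_def _ _ _ _ _ _ _ (Hw k)).
        pose proof (Cmod_sub_triangle v v' (w k)) as T1. rewrite (Cmod_sub_sym v v') in T1.
        pose proof (Cmod_sub_triangle v' v (w k)) as T2. lra.
      - replace (fin f0 v' + c (S k) - (fin f0 v + c (S k)))%C
          with (fin f0 v' - fin f0 v)%C by ring.
        apply H1; auto. }
    split; [auto|]. split; [|auto]. apply Hdisc; auto.
Qed.

(* Pulling back along the orbit contracts by [1/2] at every step. *)
Lemma code_shadow w z n v y : (forall k, pole (w k)) -> code f0 c del w z ->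
  Fit f0 c n z = Some v -> Cmod (y - v) <= 1 ->
  exists x, Fit f0 c n x = Some y /\ Cmod (x - z) <= (/ 2) ^ n * Cmod (y - v).
Proof.
  intros Hw Hz. revert v y. induction n as [|n IH]; intros v y Ev Hy.
  - simpl in Ev. injection Ev as <-. exists y. split; [reflexivity|]. simpl. lra.
  - destruct (Fit_S_inv _ _ _ _ _ Ev) as [u [Eu [Hu ->]]].
    destruct (follows_step w n z u Hw (Hz (S n)) Eu) as [A1 [A2 [A3 _]]].
    pose proof (ku_lift _ _ _ _ _ _ _ (Hw (S n))) as HL.
    pose proof (ku_polar _ _ _ _ _ _ _ (Hw n)) as Hp.
    pose proof (polar_K _ _ _ _ _ _ Hp) as HK.
    set (Q := lift_const K m) in *.
    assert (HQ : 0 < Q).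
    { apply Rmult_lt_0_compat; apply pow_lt; lra. }
    assert (Hdist : Cmod (fin f0 u - (y - c (S n))) = Cmod (y - (fin f0 u + c (S n)))).
    { rewrite Cmod_sub_sym. f_equal. ring. }
    set (D := Cmod (y - (fin f0 u + c (S n)))) in *.
    assert (HD : 0 <= D) by apply Cmod_ge_0.
    destruct (polar_lift _ _ _ _ _ _ Hp u (y - c (S n))%C) as [x [Hx1 [Hx2 Hx3]]];
      try lra.
    { rewrite Hdist. fold (lift_const K m). fold Q. nra. }
    rewrite Hdist in Hx3. fold (lift_const K m) in Hx3. fold Q in Hx3.
    (* The lift gives [|f u| |x - u| <= Q |u - w n| D <= Q D], while
       [|f u| >= |w (n+1)|/2 > 2 Q]. *)
    assert (Hxu : Cmod (x - u) <= / 2 * D).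
    { pose proof (Cmod_ge_0 (x - u)).
      assert (Q * Cmod (u - w n) * D <= Q * 1 * D).
      { apply Rmult_le_compat_r; [auto|]. apply Rmult_le_compat_l; lra. }
      assert (2 * Q * Cmod (x - u) <= Cmod (fin f0 u) * Cmod (x - u))
        by (apply Rmult_le_compat_r; lra).
      apply Rmult_le_reg_l with (2 * Q); lra. }
    destruct (IH u x Eu) as [x0 [E0 H0]]; [lra|].
    exists x0. split.
    + rewrite (Fit_S f0 c n x0 x E0).
      * f_equal. rewrite Hx2. ring.
      * apply (ku_def _ _ _ _ _ _ _ (Hw n)).
        pose proof (Cmod_sub_triangle u x (w n)) as T1. rewrite (Cmod_sub_sym u x) in T1.
        pose proof (Cmod_sub_triangle x u (w n)) as T2. lra.
    + eapply Rle_trans; [exact H0|]. simpl.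
      assert (0 < (/ 2) ^ n) by (apply pow_lt; lra). nra.
Qed.

(** Pulling the pole [w n] back along the orbit gives a point within [2^(-n)] of [z] at which
    iterate [n + 1] is undefined in the plane. Every neighbourhood of [z] thus violates the
    finiteness clause of [fatou]. *)
Lemma code_julia w z : (forall k, pole (w k)) -> code f0 c del w z -> julia f0 c z.
Proof.
  intros Hw Hz [e [He [Hdef _]]].
  destruct (pow_lt_1_zero (/ 2)) with (y := e) as [n Hn]; auto.
  { rewrite Rabs_pos_eq; lra. }
  specialize (Hn n (Nat.le_refl n)).
  assert (Hpos : 0 < (/ 2) ^ n) by (apply pow_lt; lra).
  rewrite Rabs_pos_eq in Hn by lra.
  destruct (Hz n n (Nat.le_refl n)) as [v [Ev Hv]].
  rewrite Cmod_sub_sym in Hv.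
  destruct (code_shadow w z n v (w n) Hw Hz Ev ltac:(lra)) as [x [Ex Hx]].
  apply (Hdef (S n) x).
  - unfold ballC. pose proof (Cmod_ge_0 (w n - v)). nra.
  - simpl. rewrite Ex, (ku_None _ _ _ _ _ _ _ (Hw n)). reflexivity.
Qed.

Lemma code_escaping w z : (forall k, pole (w k)) -> code f0 c del w z ->
  (forall B, exists N, forall n, (N <= n)%nat -> B <= Cmod (w n)) ->
  escaping f0 c z.
Proof.
  intros Hw Hz Hinf. split; [|split].
  - apply (code_julia w); auto.
  - intros n E. destruct (Hz n n (Nat.le_refl n)) as [v [Ev _]]. congruence.
  - intros B. destruct (Hinf (B + 2)) as [N HN]. exists N. intros n Hn.
    specialize (HN n Hn). destruct (Hz n n (Nat.le_refl n)) as [v [Ev Hv]].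
    rewrite (fin_Some _ _ _ Ev).
    pose proof (Cmod_le_sub (w n) v) as T. rewrite Cmod_sub_sym in T. lra.
Qed.

(** Arrival near [a] contributes the exponent [1 + 1/m] and departure from it [beta/m]; both are
    attributed to the same pole. *)
Definition expansion (a : C) : R :=
  lip_const K m * Rpower (Cmod a) (1 + / INR m + beta / INR m).

Lemma lip_const_ge_1 : (1 <= m)%nat -> 1 <= K -> 1 <= lip_const K m.
Proof.
  intros Hm HK. unfold lip_const.
  assert (1 <= INR m) by (apply (le_INR 1); auto).
  assert (1 <= 2 ^ S m) by (apply pow_R1_Rle; lra).
  assert (0 < / INR m) by (apply Rinv_0_lt_compat; lra).
  assert (1 <= Rpower (2 * K) (/ INR m)).
  { rewrite <- (Rpower_O (2 * K)) by lra. apply Rle_Rpower; lra. }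
  assert (1 <= K ^ 2) by nra.
  assert (1 <= K ^ 2 * INR m) by nra.
  assert (1 <= K ^ 2 * INR m * 2 ^ S m) by nra. nra.
Qed.

(** This is [polar_lipschitz] for the bound [2 B] and [rho = 1/q], where [q^m = 2 K B |a|^beta]. *)
Lemma pole_step_lipschitz a B x y : pole a -> 1 <= B ->
  0 < Cmod (x - a) < r -> 0 < Cmod (y - a) < r ->
  Cmod (fin f0 x) <= 2 * B -> Cmod (fin f0 y) <= 2 * B ->
  Cmod (fin f0 x - fin f0 y) <=
    lip_const K m * Rpower B (1 + / INR m) * Rpower (Cmod a) (beta / INR m) * Cmod (x - y).
Proof.
  intros Ha HB Hx Hy Bx By.
  pose proof (ku_polar _ _ _ _ _ _ _ Ha) as Hp.
  pose proof (polar_K _ _ _ _ _ _ Hp) as HK.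
  pose proof (ku_ge4 _ _ _ _ _ _ _ Ha) as H4.
  assert (Hm : 1 <= INR m) by (apply (le_INR 1), (polar_m _ _ _ _ _ _ Hp)).
  set (al := Rpower (Cmod a) (- beta)) in *.
  assert (Hal : 0 < al) by apply exp_pos.
  assert (HKB : 0 < K * (2 * B)) by nra.
  set (q := Rpower (2 * K) (/ INR m) * Rpower B (/ INR m) * Rpower (Cmod a) (beta / INR m)).
  assert (Hq : 0 < q).
  { unfold q. repeat apply Rmult_lt_0_compat; apply exp_pos. }
  assert (Hqm : q ^ m = 2 * K * B * / al).
  { rewrite <- Rpower_pow by auto. unfold q.
    rewrite !Rpower_mult_distr by (try apply exp_pos; try apply Rmult_lt_0_compat; try apply exp_pos; lra).
    replace (beta / INR m) with (beta * / INR m) by reflexivity.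
    rewrite <- Rpower_mult.
    rewrite Rpower_mult_distr by (try apply exp_pos; nra).
    rewrite Rpower_mult, Rinv_l, Rpower_1 by (try lra; repeat apply Rmult_lt_0_compat; try apply exp_pos; lra).
    unfold al. rewrite Rpower_Ropp, Rinv_inv. reflexivity. }
  pose proof (polar_lipschitz _ _ _ _ _ _ Hp y x (2 * B) (/ q) Hy Hx By Bx
    (Rinv_0_lt_compat _ Hq)) as HL.
  rewrite pow_inv, Hqm in HL.
  specialize (HL ltac:(field; lra)).
  apply Rmult_le_compat_l with (r := q) in HL; [|lra].
  rewrite <- Rmult_assoc, Rinv_r, Rmult_1_l in HL by lra.
  eapply Rle_trans; [exact HL|]. apply Req_le.
  unfold q, lip_const. rewrite Rpower_plus, Rpower_1 by lra. ring.
Qed.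

(** The one-step bounds telescope. The arrival factor of the last pole is kept apart as a power of
    [B], since at index [n] the two words may differ. *)
Lemma code_expansion w w' z z' n B v v' : (forall k, pole (w k)) -> (forall k, pole (w' k)) ->
  code f0 c del w z -> code f0 c del w' z' -> agree n w w' ->
  Cmod (w n) <= B -> Cmod (w' n) <= B ->
  Fit f0 c n z = Some v -> Fit f0 c n z' = Some v' ->
  Cmod (v - v') <= Rpower B (1 + / INR m) * weight expansion w n * Cmod (z - z').
Proof.
  intros Hw Hw' Hz Hz'. revert B v v'.
  assert (Hm : 1 <= INR m)
    by (apply (le_INR 1), (polar_m _ _ _ _ _ _ (ku_polar _ _ _ _ _ _ _ (Hw O)))).
  assert (Hk : 0 < / INR m) by (apply Rinv_0_lt_compat; lra).
  induction n as [|n IH]; intros B v v' Hag HB HB' Ev Ev'.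
  - simpl in *. injection Ev as <-. injection Ev' as <-.
    pose proof (ku_ge4 _ _ _ _ _ _ _ (Hw O)).
    assert (1 <= Rpower B (1 + / INR m)).
    { apply Rle_trans with (Rpower B 0); [rewrite Rpower_O; lra|apply Rle_Rpower; lra]. }
    pose proof (Cmod_ge_0 (z - z')). nra.
  - destruct (Fit_S_inv _ _ _ _ _ Ev) as [u [Eu [Hu ->]]].
    destruct (Fit_S_inv _ _ _ _ _ Ev') as [u' [Eu' [Hu' ->]]].
    destruct (follows_step w n z u Hw (Hz (S n)) Eu) as [A1 [A2 [_ A3]]].
    destruct (follows_step w' n z' u' Hw' (Hz' (S n)) Eu') as [A1' [A2' [_ A3']]].
    assert (Hwn : w n = w' n) by (apply Hag; lia). rewrite <- Hwn in A1', A2'.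
    pose proof (ku_ge4 _ _ _ _ _ _ _ (Hw (S n))).
    pose proof (ku_ge4 _ _ _ _ _ _ _ (Hw n)).
    (* At index [n] the words still agree, so [B] may be taken to be [|w n|]; its power then merges
       with the departure factor into [expansion (w n)]. *)
    assert (IH' : Cmod (u - u') <=
      Rpower (Cmod (w n)) (1 + / INR m) * weight expansion w n * Cmod (z - z')).
    { apply IH; auto; try lra.
      - intros k Hk'. apply Hag; lia.
      - rewrite Hwn; lra. }
    pose proof (pole_step_lipschitz (w n) B u u' (Hw n) ltac:(lra) ltac:(lra) ltac:(lra)
      ltac:(lra) ltac:(lra)) as HL.
    replace (fin f0 u + c (S n) - (fin f0 u' + c (S n)))%C with (fin f0 u - fin f0 u')%C by ring.
    eapply Rle_trans; [exact HL|].
    assert (HL0 : 0 <= lip_const K m * Rpower B (1 + / INR m) * Rpower (Cmod (w n)) (beta / INR m)).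
    { apply Rmult_le_pos; [apply Rmult_le_pos|]; try (apply Rlt_le, exp_pos).
      pose proof (ku_polar _ _ _ _ _ _ _ (Hw n)) as Hp.
      pose proof (lip_const_ge_1 (polar_m _ _ _ _ _ _ Hp) (polar_K _ _ _ _ _ _ Hp)). lra. }
    eapply Rle_trans; [apply Rmult_le_compat_l; [exact HL0|exact IH']|].
    apply Req_le. simpl. unfold expansion at 3.
    rewrite (Rpower_plus (1 + / INR m) (beta / INR m)). ring.
Qed.

End Orbits.


(** * Choice of the finite sets of poles *)

(** Otherwise, adding again and again a point outside the list of those already chosen gives a
    bounded sequence of [d]-separated points, two of which would lie within [d/2] of a cluster
    point. *)
Lemma separated_bounded_finite (X : C -> Prop) (d B : R) : 0 < d ->
  (forall a b, X a -> X b -> a <> b -> d <= Cmod (a - b)) ->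
  exists L : list C, forall a, X a -> Cmod a <= B -> In a L.
Proof.
  intros Hd Hsep. apply NNPP. intros Hno.
  destruct (choice_function (list C) C (fun L a => X a /\ Cmod a <= B /\ ~ In a L)) as [f Hf].
  { intros L. apply NNPP. intros Hno2. apply Hno. exists L. intros a Ha HB.
    apply NNPP. intros Hin. apply Hno2. exists a; auto. }
  set (Ls := fix Ls n := match n with O => nil | S k => f (Ls k) :: Ls k end).
  set (u := fun n => f (Ls n)).
  assert (Hin : forall k n, (k < n)%nat -> In (u k) (Ls n)).
  { intros k n Hk. induction Hk as [|n Hk IH]; [left; reflexivity|right; exact IH]. }
  assert (Hne : forall k n, (k < n)%nat -> u n <> u k).
  { intros k n Hk E. destruct (Hf (Ls n)) as [_ [_ Hni]]. apply Hni.
    fold (u n). rewrite E. apply Hin; auto. }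
  destruct (bounded_cluster u B) as [l Hl].
  { intros n. apply Hf. }
  destruct (Hl (d / 2) ltac:(lra) O) as [k [_ Hk]].
  destruct (Hl (d / 2) ltac:(lra) (S k)) as [n [Hn Hn2]].
  assert (d <= Cmod (u n - u k)).
  { apply Hsep; try apply Hf. apply Hne; lia. }
  pose proof (Cmod_sub_triangle (u n) l (u k)) as T. rewrite (Cmod_sub_sym l (u k)) in T. lra.
Qed.

Lemma lsum_incl {A} (w : A -> R) (l L : list A) :
  (forall a, 0 <= w a) -> NoDup l -> incl l L -> lsum w l <= lsum w L.
Proof.
  intros Hw Hnd. revert L. induction Hnd as [|a l Ha Hnd IH]; intros L Hin.
  - apply lsum_nonneg. auto.
  - destruct (in_split a L) as [L1 [L2 ->]]; [apply Hin; left; auto|].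
    assert (E : lsum w (L1 ++ a :: L2) = w a + lsum w (L1 ++ L2)).
    { unfold lsum. clear. induction L1 as [|b L1 IH]; simpl; [reflexivity|].
      rewrite IH. ring. }
    rewrite E. unfold lsum at 1; simpl. fold (lsum w l).
    apply Rplus_le_compat_l, IH. intros b Hb.
    assert (Hb' : In b (L1 ++ a :: L2)) by (apply Hin; right; auto).
    apply in_app_iff in Hb'. apply in_app_iff. destruct Hb' as [|[<-|]]; tauto.
Qed.

Lemma lsum_filter_split {A} (w : A -> R) (p : A -> bool) (l : list A) :
  lsum w l = lsum w (filter p l) + lsum w (filter (fun a => negb (p a)) l).
Proof.
  unfold lsum. induction l as [|a l IH]; simpl; [lra|].
  destruct (p a); simpl; rewrite IH; ring.
Qed.

(** Discarding the members of [L] lowers a finite sum by at most the total over [L], so the sums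
    over the remaining poles are still unbounded. *)
Lemma far_poles_divergence (f : C -> Chat) (k : nat) (t B : R) (L : list C) :
  ~ pole_series_cv f k t ->
  exists T, NoDup T /\ (forall a, In a T -> pole_mult f a k /\ ~ In a L) /\
    B <= lsum (fun a => Rpower (Cmod a) (- t)) T.
Proof.
  intros Hdiv. set (w := fun a : C => Rpower (Cmod a) (- t)).
  apply NNPP. intros Hno. apply Hdiv. exists (B + lsum w L).
  intros l Hnd Hl. apply Rnot_lt_le. intros Hlt. apply Hno.
  change (B + lsum w L < lsum w l) in Hlt.
  set (p := fun a => if excluded_middle_informative (In a L) then true else false).
  exists (filter (fun a => negb (p a)) l). split; [apply NoDup_filter; auto|]. split.
  - intros a Ha. apply filter_In in Ha. destruct Ha as [Ha Hp].
    rewrite Forall_forall in Hl. split; [apply (Hl a Ha)|].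
    unfold p in Hp. destruct excluded_middle_informative; [discriminate|auto].
  - rewrite (lsum_filter_split w p l) in Hlt.
    assert (lsum w (filter p l) <= lsum w L); [|fold w; lra].
    apply lsum_incl; [intros a; apply Rlt_le, exp_pos|apply NoDup_filter; auto|].
    intros a Ha. apply filter_In in Ha. destruct Ha as [_ Hp].
    unfold p in Hp. destruct excluded_middle_informative; [auto|discriminate].
Qed.

(** The level [j] advances only when the next value of [D] is at most the current power of [2], and
    waits otherwise. Powers of [2] are unbounded, so every wait ends; [D0] takes care of the initial
    level. *)
Lemma slow_schedule (D : nat -> R) :
  exists (j : nat -> nat) (D0 : R), 0 < D0 /\ (forall k, D (j k) <= D0 * 2 ^ k) /\
    forall J, exists N, forall k, (N <= k)%nat -> (J <= j k)%nat.
Proof.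
  set (j := fix j k := match k with
    | O => O
    | S k' => if Rle_dec (D (S (j k'))) (2 ^ S k') then S (j k') else j k' end).
  set (D0 := Rmax 1 (D O)).
  assert (HD0 : 1 <= D0) by apply Rmax_l.
  assert (Hmono : forall k k', (k <= k')%nat -> (j k <= j k')%nat).
  { intros k k' Hk. induction Hk as [|k' Hk IH]; [lia|]. simpl.
    destruct Rle_dec; lia. }
  exists j, D0. split; [lra|]. split.
  - induction k as [|k IH].
    + simpl. rewrite Rmult_1_r. apply Rmax_r.
    + assert (0 < 2 ^ k) by (apply pow_lt; lra).
      simpl j. destruct Rle_dec as [Hle|Hle].
      * eapply Rle_trans; [exact Hle|]. simpl. nra.
      * eapply Rle_trans; [exact IH|]. simpl. nra.
  - induction J as [|J [N HN]].
    + exists O. intros; lia.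
    + destruct (Pow_x_infinity 2) with (b := Rabs (D (S J))) as [N1 HN1].
      { rewrite Rabs_pos_eq; lra. }
      set (k0 := Nat.max N N1).
      exists (S k0). intros k Hk. eapply Nat.le_trans; [|apply (Hmono (S k0)); lia].
      pose proof (HN k0 ltac:(lia)) as HJ.
      destruct (Nat.eq_dec (j k0) J) as [E|E].
      * simpl. rewrite E. destruct Rle_dec as [_|Hn]; [lia|]. exfalso. apply Hn.
        specialize (HN1 (S k0) ltac:(lia)).
        rewrite (Rabs_pos_eq (2 ^ S k0)) in HN1 by (apply pow_le; lra).
        pose proof (Rle_abs (D (S J))). simpl in HN1. lra.
      * pose proof (Hmono k0 (S k0) ltac:(lia)). lia.
Qed.

Lemma list_Cmod_bound (T : list C) : exists B, 1 <= B /\ forall a, In a T -> Cmod a <= B.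
Proof.
  induction T as [|b T [B [HB H]]].
  - exists 1. split; [lra|]. intros a [].
  - exists (Rmax B (Cmod b)). split; [eapply Rle_trans; [exact HB|apply Rmax_l]|].
    intros a [<-|Ha]; [apply Rmax_r|].
    eapply Rle_trans; [apply H; auto|apply Rmax_l].
Qed.

(** * From the hypotheses to the weighted tree of poles *)

Lemma weight_Rpower {A} (g : A -> R) (s : R) (x : nat -> A) (n : nat) :
  (forall a, 0 < g a) ->
  weight (fun a => Rpower (g a) (- s) / 2) x n = Rpower (weight g x n) (- s) * (/ 2) ^ n.
Proof.
  intros Hg. induction n as [|n IH]; simpl.
  - unfold Rpower. rewrite ln_1, Rmult_0_r, exp_0. ring.
  - rewrite IH, <- Rpower_mult_distr by (auto; apply weight_pos; auto). field.
Qed.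

Lemma polar_of_estimates (f0 : C -> Chat) (a : C) (m : nat) (K beta r : R) :
  meromorphic f0 -> 1 <= K -> pole_mult f0 a m ->
  (forall z, 0 < Cmod (z - a) < r -> f0 z <> None) ->
  (forall z, 0 < Cmod (Cminus z a) < r ->
     let A := Rpower (Cmod a) (- beta) * Rpower (Cmod (Cminus z a)) (- INR m) in
     / K * A <= Cmod (fin f0 z) <= K * A /\
     forall d, cderiv (fin f0) z d ->
       / K * (INR m * A / Cmod (Cminus z a)) <= Cmod d <=
       K * (INR m * A / Cmod (Cminus z a))) ->
  polar (fin f0) a m K (Rpower (Cmod a) (- beta)) r.
Proof.
  intros [_ [Hmer _]] HK [Hpole [Hm [L [HL Hlim]]]] Hdef Hest.
  set (al := Rpower (Cmod a) (- beta)) in *.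
  assert (Hal : 0 < al) by apply exp_pos.
  assert (Hm1 : 1 <= INR m) by (apply (le_INR 1); auto).
  assert (Hpw : forall z, 0 < Cmod (z - a) -> Rpower (Cmod (z - a)) (- INR m) = / Cmod (z - a) ^ m).
  { intros z Hz. rewrite Rpower_Ropp, Rpower_pow by auto. reflexivity. }
  constructor; auto.
  - exists L. split; [auto|]. intros eps He. destruct (Hlim eps He) as [d [Hd H]].
    exists d. split; [auto|]. intros z Hz. destruct (H z Hz) as [_ H2].
    rewrite pow_n_Cpow in H2. exact H2.
  - intros z Hz. destruct (Hest z Hz) as [[H1 _] _]. rewrite Hpw in H1 by lra.
    pose proof (pow_lt _ m (proj1 Hz)) as Hp.
    apply Rmult_le_compat_r with (r := K * Cmod (z - a) ^ m) in H1; [|nra].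
    replace (/ K * (al * / Cmod (z - a) ^ m) * (K * Cmod (z - a) ^ m)) with al in H1
      by (field; lra). lra.
  - intros z Hz. destruct (Hest z Hz) as [[_ H1] _]. rewrite Hpw in H1 by lra.
    pose proof (pow_lt _ m (proj1 Hz)) as Hp.
    apply Rmult_le_compat_r with (r := Cmod (z - a) ^ m) in H1; [|lra].
    replace (K * (al * / Cmod (z - a) ^ m) * Cmod (z - a) ^ m) with (K * al) in H1
      by (field; lra). lra.
  - intros z Hz. destruct (Hmer z (Hdef z Hz)) as [d Hd].
    exists d. split; [exact (cderiv_differentiable _ _ _ Hd)|].
    destruct (Hest z Hz) as [_ H]. specialize (H d Hd). rewrite Hpw in H by lra.
    pose proof (pow_lt _ m (proj1 Hz)) as Hp.
    set (s := Cmod (z - a)) in *. destruct H as [H1 H2]. simpl. split.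
    + apply Rmult_le_compat_r with (r := K * (s * s ^ m)) in H1.
      2:{ apply Rmult_le_pos; [lra|]. apply Rmult_le_pos; lra. }
      replace (/ K * (INR m * (al * / s ^ m) / s) * (K * (s * s ^ m)))
        with (INR m * al) in H1 by (field; lra).
      nra.
    + apply Rmult_le_compat_r with (r := s * s ^ m) in H2.
      2:{ apply Rmult_le_pos; lra. }
      replace (K * (INR m * (al * / s ^ m) / s) * (s * s ^ m))
        with (K * INR m * al) in H2 by (field; lra). lra.
Qed.

Theorem theorem5p3 (f0 : C -> Chat) (rho : R)
  (Pstar : C -> Prop) (Rstar Rdag : R) (M : nat) (beta : R) (Mstar : nat) :
  transcendental_meromorphic f0 ->
  has_order f0 rho -> 0 < rho ->
  (* (KU1) *)
  ~ asymptotic_value_inf f0 ->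
  (* (KU2) *)
  (forall a, Pstar a -> is_pole f0 a) ->
  (exists l : list C, forall a, is_pole f0 a -> ~ Pstar a -> In a l) ->
  0 < Rstar ->
  (forall a, Pstar a -> exists eta, 0 < eta /\
     forall w, sing f0 w -> 2 * Rstar + eta <= Cmod (Cminus w a)) ->
  (* (KU3) *)
  0 < Rdag ->
  (forall a1 a2, is_pole f0 a1 -> is_pole f0 a2 -> a1 <> a2 ->
     forall z, ~ (ballC a1 Rdag z /\ ballC a2 Rdag z)) ->
  (* (KU4) *)
  0 <= beta ->
  (exists K, 1 <= K /\ forall a m, Pstar a -> pole_mult f0 a m ->
     (1 <= m <= M)%nat /\
     forall z, 0 < Cmod (Cminus z a) < Rdag ->
       let A := Rpower (Cmod a) (- beta) * Rpower (Cmod (Cminus z a)) (- INR m) in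
       / K * A <= Cmod (fin f0 z) <= K * A /\
       forall d, cderiv (fin f0) z d ->
         / K * (INR m * A / Cmod (Cminus z a)) <= Cmod d <=
         K * (INR m * A / Cmod (Cminus z a))) ->
  is_Mstar f0 rho M Mstar ->
  exists eps, 0 < eps /\
    forall c : nat -> C, (forall n, Cmod (c n) < eps) ->
      Rbar_le (Finite (rho * INR Mstar / (beta + INR Mstar + 1)))
              (hausdorff_dim (escaping f0 c)).
Proof.
  intros [Hmer _] _ _ _ _ [l0 Hl0] _ _ HRd Hdisj Hbeta [K [HK HKU4]]
    [[Hm _] [[_ Hdiv] _]].
  set (m := Mstar) in *.
  (* This is the radius of the balls to be visited and also the bound on the perturbations. The
     quarter makes distinct poles [4 del] apart and leaves room for [polar_lift]; the bound [1] is
     the range of [code_shadow]. *)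
  set (del := Rmin 1 (Rdag / 4)).
  assert (Hdel : 0 < del) by (apply Rmin_pos; lra).
  assert (Hdel1 : del <= 1) by apply Rmin_l.
  assert (Hdel4 : 4 * del <= Rdag) by (pose proof (Rmin_r 1 (Rdag / 4)); fold del in H; lra).
  exists del. split; [auto|]. intros c Hc.
  assert (Hm1 : 1 <= INR m) by (apply (le_INR 1); auto).
  assert (Hsep : forall a b, is_pole f0 a -> is_pole f0 b -> a <> b ->
    4 * del <= Cmod (a - b)).
  { intros a b Ha Hb Hab. apply Rnot_lt_le. intros Hlt.
    apply (Hdisj a b Ha Hb Hab a). unfold ballC. rewrite Cmod_sub_self. lra. }
  (* The three summands are the three size thresholds of [ku_pole]. *)
  set (R0 := 4 + 6 * K / del ^ m + 4 * lift_const K m).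
  assert (Hdm : 0 < del ^ m) by (apply pow_lt; auto).
  assert (HQ : 0 < lift_const K m) by (apply Rmult_lt_0_compat; apply pow_lt; lra).
  assert (H6 : 0 < 6 * K / del ^ m) by (apply Rdiv_lt_0_compat; lra).
  assert (Hku : forall a, Pstar a -> pole_mult f0 a m -> R0 < Cmod a ->
    ku_pole f0 m K beta Rdag del a).
  { intros a Ha Hpm HR. destruct (HKU4 a m Ha Hpm) as [_ Hest].
    assert (Hdef : forall z, 0 < Cmod (z - a) < Rdag -> f0 z <> None).
    { intros z Hz E. apply (Hdisj z a E (proj1 Hpm)) with (z := z).
      - apply Cmod_sub_pos_neq; lra.
      - unfold ballC. rewrite Cmod_sub_self. lra. }
    unfold R0 in HR. constructor; auto; try lra.
    - apply Hpm.
    - apply polar_of_estimates; auto.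
    - assert (Hd : 6 * K / del ^ m * del ^ m = 6 * K) by (field; lra). nra. }
  (* The dimension is an infimum, so it suffices that no [s] below the claimed bound has zero
     measure. *)
  unfold hausdorff_dim, Rbar_glb. destruct Rbar_ex_glb as [g [Hg0 Hg]]. cbn [proj1_sig].
  apply Hg. intros x [s [Hs [-> Hmeas]]]. simpl. apply Rnot_lt_le. intros Hlt.
  revert Hmeas.
  (* This is [(beta + m + 1)/m], so that [kap * s] is the critical quantity compared with [rho]. *)
  set (kap := 1 + / INR m + beta / INR m).
  set (C1 := lip_const K m).
  assert (HC1 : 1 <= C1) by (apply lip_const_ge_1; auto).
  assert (Hinvm : 0 < / INR m) by (apply Rinv_0_lt_compat; lra).
  assert (Hkap : 0 <= kap).
  { assert (0 <= beta / INR m) by (apply Rmult_le_pos; lra). unfold kap; lra. }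
  assert (Hu : kap * s < rho).
  { apply Rlt_div_r in Hlt; [|lra].
    apply Rmult_lt_reg_r with (INR m); [lra|].
    replace (kap * s * INR m) with (s * (beta + INR m + 1)) by (unfold kap; field; lra).
    lra. }
  (* Halving each weight produces the factor [2^(-n)] that later absorbs the size of the last
     pole. *)
  set (w := fun a => Rpower (expansion m K beta a) (- s) / 2).
  assert (Hexp : forall a, 0 < expansion m K beta a).
  { intros a. apply Rmult_lt_0_compat; [fold C1; lra|apply exp_pos]. }
  assert (Hw : forall a, 4 <= Cmod a -> w a <= / 2).
  { intros a Ha. unfold w. rewrite Rpower_Ropp.
    assert (1 <= expansion m K beta a).
    { unfold expansion. fold C1 kap.
      assert (1 <= Rpower (Cmod a) kap); [|nra].
      rewrite <- (Rpower_O (Cmod a)) by lra. apply Rle_Rpower; lra. }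
    assert (1 <= Rpower (expansion m K beta a) s).
    { rewrite <- (Rpower_O (expansion m K beta a)) by auto. apply Rle_Rpower; lra. }
    assert (/ Rpower (expansion m K beta a) s <= / 1) by (apply Rinv_le_contravar; lra).
    lra. }
  assert (Hlevel : forall j : nat, exists T, NoDup T /\
    (forall a, In a T -> ku_pole f0 m K beta Rdag del a /\ INR j <= Cmod a) /\
    1 <= lsum w T).
  { intros j.
    destruct (separated_bounded_finite (is_pole f0) (4 * del) (R0 + INR j)) as [L HL];
      [lra|auto|].
    (* The target [2 C1^s] offsets both the halving and the constant in [expansion], so the weights
       of a level sum to at least [1]. Excluding [l0 ++ L] leaves only poles in [Pstar] of modulus
       above [R0 + j], which makes the orbits escape. *)
    destruct (far_poles_divergence f0 m (kap * s) (2 * Rpower C1 s) (l0 ++ L)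
      (Hdiv _ Hu)) as [T [HT1 [HT2 HT3]]].
    exists T. split; [auto|]. split.
    - intros a Ha. destruct (HT2 a Ha) as [Hpm Hn].
      assert (Hfar : R0 + INR j < Cmod a).
      { apply Rnot_le_lt. intros Hle. apply Hn, in_app_iff. right.
        apply HL; auto. apply Hpm. }
      pose proof (pos_INR j). unfold R0 in Hfar. split; [|lra].
      apply Hku; auto.
      + apply NNPP. intros Hnp. apply Hn, in_app_iff. left. apply Hl0; auto. apply Hpm.
      + unfold R0. lra.
    - assert (E : forall a, w a = / (2 * Rpower C1 s) * Rpower (Cmod a) (- (kap * s))).
      { intros a. unfold w, expansion. fold C1 kap.
        rewrite <- Rpower_mult_distr by (try apply exp_pos; lra).
        rewrite Rpower_mult, (Rpower_Ropp C1).
        replace (kap * - s) with (- (kap * s)) by ring.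
        field. apply Rgt_not_eq, exp_pos. }
      assert (HCs : 0 < Rpower C1 s) by apply exp_pos.
      apply Rle_trans with (lsum (fun a => / (2 * Rpower C1 s) * Rpower (Cmod a) (- (kap * s))) T).
      + rewrite lsum_scal. apply Rmult_le_reg_l with (2 * Rpower C1 s); [lra|].
        rewrite <- Rmult_assoc, Rinv_r by lra. lra.
      + apply lsum_mono. intros a _. rewrite E. lra. }
  destruct (choice_function _ _ _ Hlevel) as [T HT].
  destruct (choice_function _ _ _ (fun j => list_Cmod_bound (T j))) as [Bd HBd].
  (* Levels are repeated until [Bd^((1 + 1/m) s)], the arrival factor at the last pole raised to the
     power [s], is at most [D0 2^k]. *)
  destruct (slow_schedule (fun j => Rpower (Bd j) ((1 + / INR m) * s))) as [j [D0 [HD0 [HD Hj]]]].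
  apply (hausdorff_measure_neq_0 (escaping f0 c) (fun k => T (j k)) w
    (code f0 c del) s (D0 * Rpower del (- s))).
  - apply Rmult_le_pos; [lra|apply Rlt_le, exp_pos].
  - intros a. unfold w. apply Rmult_lt_0_compat; [apply exp_pos|lra].
  - intros n a Ha. apply Hw. destruct (HT (j n)) as [_ [HP _]].
    apply (ku_ge4 _ _ _ _ _ _ _ (proj1 (HP a Ha))).
  - intros n. apply HT.
  - intros n. apply HT.
  - intros x Hx.
    assert (Hpx : forall k, ku_pole f0 m K beta Rdag del (x k)).
    { intros k. apply (proj1 (proj2 (HT (j k))) _ (Hx k)). }
    destruct (code_exists f0 c m K beta Rdag del Hdel Hdel1 Hdel4 Hbeta Hc x Hpx) as [z Hz].
    exists z. split; [|exact Hz].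
    apply (code_escaping f0 c m K beta Rdag del Hdel Hdel1 Hdel4 Hc x z Hpx Hz).
    intros B. destruct (INR_unbounded B) as [J HJ]. destruct (Hj J) as [N HN].
    exists N. intros n Hn. specialize (HN n Hn). apply le_INR in HN.
    pose proof (proj2 (proj1 (proj2 (HT (j n))) _ (Hx n))). lra.
  - intros x y n z z' r Hx Hy Hag Hne Hz Hz' Hr Hzz.
    assert (Hpx : forall k, ku_pole f0 m K beta Rdag del (x k)).
    { intros k. apply (proj1 (proj2 (HT (j k))) _ (Hx k)). }
    assert (Hpy : forall k, ku_pole f0 m K beta Rdag del (y k)).
    { intros k. apply (proj1 (proj2 (HT (j k))) _ (Hy k)). }
    destruct (Hz n n (Nat.le_refl n)) as [v [Ev Hv]].
    destruct (Hz' n n (Nat.le_refl n)) as [v' [Ev' Hv']].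
    destruct (HBd (j n)) as [HB1 HB].
    pose proof (code_expansion f0 c m K beta Rdag del Hdel Hdel1 Hdel4 Hc x y z z' n (Bd (j n)) v v'
      Hpx Hpy Hz Hz' Hag (HB _ (Hx n)) (HB _ (Hy n)) Ev Ev') as HL.
    (* The two poles are at least [4 del] apart, and each orbit point is within [del] of its own. *)
    assert (Hgap : del <= Cmod (v - v')).
    { pose proof (Hsep (x n) (y n) (ku_None _ _ _ _ _ _ _ (Hpx n))
        (ku_None _ _ _ _ _ _ _ (Hpy n)) Hne) as H4.
      pose proof (Cmod_sub_triangle (x n) v (y n)) as T1. rewrite (Cmod_sub_sym (x n) v) in T1.
      pose proof (Cmod_sub_triangle v v' (y n)) as T2. lra. }
    set (W := weight (expansion m K beta) x n) in *.
    assert (HW : 0 < W) by (apply weight_pos; auto).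
    set (b := Rpower (Bd (j n)) (1 + / INR m)) in *.
    assert (Hb : 0 < b) by apply exp_pos.
    assert (Hbr : del <= b * W * r).
    { eapply Rle_trans; [exact Hgap|]. eapply Rle_trans; [exact HL|].
      apply Rmult_le_compat_l; auto. apply Rlt_le, Rmult_lt_0_compat; auto. }
    assert (Hpow : Rpower del s <= Rpower (Bd (j n)) ((1 + / INR m) * s) * Rpower W s * Rpower r s).
    { eapply Rle_trans; [apply Rle_Rpower_l; [exact Hs|split; [exact Hdel|exact Hbr]]|].
      apply Req_le. rewrite <- !Rpower_mult_distr by (auto; apply Rmult_lt_0_compat; auto).
      unfold b. rewrite Rpower_mult. reflexivity. }
    specialize (HD n). cbv beta in HD.
    unfold w. rewrite weight_Rpower by auto. fold W.
    rewrite !Rpower_Ropp.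
    assert (HWs : 0 < Rpower W s) by apply exp_pos.
    assert (Hds : 0 < Rpower del s) by apply exp_pos.
    assert (Hrs : 0 < Rpower r s) by apply exp_pos.
    assert (H2n : 0 < 2 ^ n) by (apply pow_lt; lra).
    (* Clearing the negative powers leaves [del^s <= D0 2^n W^s r^s], which is [Hpow] combined with
       the schedule bound [HD]. *)
    apply Rmult_le_reg_r with (Rpower W s * Rpower del s * 2 ^ n);
      [repeat apply Rmult_lt_0_compat; auto|].
    rewrite pow_inv.
    replace (/ Rpower W s * / 2 ^ n * (Rpower W s * Rpower del s * 2 ^ n))
      with (Rpower del s) by (field; lra).
    replace (D0 * / Rpower del s * Rpower r s * (Rpower W s * Rpower del s * 2 ^ n))
      with (D0 * 2 ^ n * Rpower W s * Rpower r s) by (field; lra).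
    eapply Rle_trans; [exact Hpow|].
    apply Rmult_le_compat_r; [lra|]. apply Rmult_le_compat_r; lra.
Qed.
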